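(* Let $\mathcal{H}$ be a Hilbert space, let $\Omega$ be a finitely open set in $\mathbb{M}^d$, and let $\{\lambda_i\}$ be a sequence in $\Omega$ (with $\lambda_i\in\mathbb{M}^d_{n_i}$ for each $i$) that is a set of uniqueness for $\mathrm{Hol}_{\mathcal{H}}(\Omega)$. If $\{u^k\}$ is a sequence in $\mathrm{Hol}_{\mathcal{H}}(\Omega)$ that is finitely locally uniformly bounded on $\Omega$, and for each fixed $i$, $\{u^k(\lambda_i)\}$ is a convergent sequence in $\mathcal{B}(\mathbb{C}^{n_i},\mathbb{C}^{n_i}\otimes\mathcal{H})$, then $\{u^k\}$ converges in $\mathrm{Hol}_{\mathcal{H}}(\Omega)$.
   Context: Hilbert spaces are complex. $\mathbb{M}_n^d$ is the set of $d$-tuples of $n\times n$ complex matrices, $\mathbb{M}^d=\bigcup_{n\ge1}\mathbb{M}^d_n$, and $E_n=E\cap\mathbb{M}^d_n$ for $E\subseteq\mathbb{M}^d$. The finite topology on $\mathbb{M}^d$: $\Omega$ is finitely open iff $\Omega_n$ is open in $\mathbb{M}^d_n$ for every $n$; $K$ is finitely compact iff every $K_n$ is compact and $K_n=\varnothing$ for all large $n$. For finitely open $\Omega$, $\mathrm{Hol}_{\mathcal{H}}(\Omega)$ is the set of functions $f$ on $\Omega$ such that for every $n$, $f(\lambda)\in\mathcal{B}(\mathbb{C}^n,\mathbb{C}^n\otimes\mathcal{H})$ for $\lambda\in\Omega_n$ and $f|\Omega_n$ is holomorphic; it carries the topology of uniform convergence (in operator norm) on finitely compact subsets of $\Omega$.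 A sequence $\{u^k\}$ is finitely locally uniformly bounded on $\Omega$ if for each $\lambda\in\Omega$ there is a finitely open $B$ with $\lambda\in B\subseteq\Omega$ and $\sup_k\sup_{\mu\in B}\|u^k(\mu)\|<\infty$. A sequence $\{\lambda_i\}$ in $\Omega$ is a set of uniqueness for $\mathrm{Hol}_{\mathcal{H}}(\Omega)$ if $f\in\mathrm{Hol}_{\mathcal{H}}(\Omega)$ and $f(\lambda_i)=0$ for all $i$ imply $f=0$ on $\Omega$. *)

(* Defs.v *)
From HB Require Import structures.
From mathcomp Require Import all_boot all_order all_algebra sesquilinear.
From mathcomp Require Import complex.
From mathcomp Require Import ring.
From mathcomp Require Import all_classical all_reals all_analysis.

Set Implicit Arguments.
Unset Strict Implicit.
Unset Printing Implicit Defensive.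

Import Order.TTheory GRing.Theory Num.Theory.
Import numFieldNormedType.Exports.

Local Open Scope classical_set_scope.
Local Open Scope ring_scope.

(* R[i] as a structure: the topology and norm of a [numClosedFieldType] are
   inferred from the head projection, which the bare type R[i] does not show. *)
Definition Cplx (R : realType) : numClosedFieldType := R[i]%C.

HB.mixin Record isHilbert (C : numClosedFieldType) H
    & CompleteNormedModule C H := {
  inner : {dot H for (@Num.conj C)} ;
  innerE : forall x : H, inner x x = `|x| ^+ 2
}.

#[short(type="hilbertType")]
HB.structure Definition Hilbert (C : numClosedFieldType) :=
  {H of isHilbert C H & CompleteNormedModule C H}.

(* The l^2-sum of n copies of V, with norm x |-> (\sum_i |x_i|^2)^(1/2). *)
Definition l2sum (n : nat) (V : Type) : Type := {ffun 'I_n -> V}.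

HB.instance Definition _ (C : numClosedFieldType) n (V : normedModType C) :=
  GRing.Lmodule.copy (l2sum n V) {ffun 'I_n -> V}.

Section l2norm.
Context {C : numClosedFieldType} (n : nat) {V : normedModType C}.
Implicit Types x y : l2sum n V.

Definition l2norm x : C := sqrtC (\sum_(i < n) `|x i| ^+ 2).

Lemma sum_sqr_ge0 (a : 'I_n -> C) :
  (forall i, 0 <= a i) -> 0 <= \sum_(i < n) a i ^+ 2.
Proof. by move=> a0; apply: sumr_ge0 => i _; rewrite exprn_ge0. Qed.

Lemma sum_CauchySchwarz (a b : 'I_n -> C) :
  (forall i, 0 <= a i) -> (forall i, 0 <= b i) ->
  \sum_(i < n) a i * b i <=
  sqrtC (\sum_(i < n) a i ^+ 2) * sqrtC (\sum_(i < n) b i ^+ 2).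
Proof.
move=> a0 b0; set A := \sum_(i < n) a i ^+ 2; set B := \sum_(i < n) b i ^+ 2.
have A0 : 0 <= A := sum_sqr_ge0 a0.
have B0 : 0 <= B := sum_sqr_ge0 b0.
have P0 : 0 <= \sum_(i < n) a i * b i.
  by apply: sumr_ge0 => i _; rewrite mulr_ge0.
rewrite -[leLHS]ger0_norm// -[leRHS]ger0_norm; last first.
  by rewrite mulr_ge0 ?sqrtC_ge0.
rewrite !ger0_norm ?mulr_ge0 ?sqrtC_ge0//.
rewrite -(@ler_pXn2r _ 2) ?nnegrE ?mulr_ge0 ?sqrtC_ge0//.
rewrite exprMn !sqrtCK -subr_ge0.
suff : 0 <= 2%:R * (A * B - (\sum_(i < n) a i * b i) ^+ 2).
  by rewrite pmulr_rge0 ?ltr0n.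
have -> : 2%:R * (A * B - (\sum_(i < n) a i * b i) ^+ 2) =
    \sum_(i < n) \sum_(j < n) (a i * b j - a j * b i) ^+ 2.
  transitivity (\sum_(i < n) (a i ^+ 2 * B + A * b i ^+ 2
      - 2%:R * (a i * b i * \sum_(j < n) a j * b j))).
    by rewrite sumrB big_split/= -!mulr_suml -!mulr_sumr -!mulr_suml -/A -/B;
      ring.
  apply: eq_bigr => i _; rewrite /A /B mulr_sumr mulr_suml !mulr_sumr.
  by rewrite -big_split/= -sumrB; apply: eq_bigr => j _; ring.
apply: sumr_ge0 => i _; apply: sumr_ge0 => j _.
by rewrite real_exprn_even_ge0// rpredB// rpredM// ger0_real.
Qed.

Lemma l2normD x y : l2norm (x + y) <= l2norm x + l2norm y.
Proof.
have S0 (z : l2sum n V) : 0 <= \sum_(i < n) `|z i| ^+ 2 by apply: sum_sqr_ge0.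
rewrite /l2norm -(@ler_pXn2r _ 2) ?nnegrE ?addr_ge0 ?sqrtC_ge0//.
rewrite sqrrD !sqrtCK.
apply: (@le_trans _ _ (\sum_(i < n) (`|x i| + `|y i|) ^+ 2)).
  apply: ler_sum => i _; rewrite ffunE ler_pXn2r ?nnegrE ?addr_ge0//.
  exact: ler_normD.
under eq_bigr do rewrite sqrrD.
rewrite 2!big_split/= lerD2r lerD2l sumrMnl lerMn2r/=.
exact: sum_CauchySchwarz.
Qed.

Lemma l2normZ (l : C) x : l2norm (l *: x) = `|l| * l2norm x.
Proof.
rewrite /l2norm; under eq_bigr do rewrite ffunE normrZ exprMn.
rewrite -mulr_sumr sqrtCM ?nnegrE ?exprn_ge0 ?sum_sqr_ge0//.
by rewrite sqrCK.
Qed.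

Lemma l2norm_eq0 x : l2norm x = 0 -> x = 0.
Proof.
move=> /eqP; rewrite sqrtC_eq0 psumr_eq0; last by move=> i _; rewrite exprn_ge0.
move=> /allP x0; apply/ffunP => i; rewrite ffunE; apply/eqP.
by have := x0 i (mem_index_enum i); rewrite expf_eq0/= normr_eq0.
Qed.

HB.instance Definition _ :=
  Lmodule_isNormed.Build C (l2sum n V) l2normD l2normZ l2norm_eq0.

End l2norm.

Definition bounded_linear (C : numFieldType) (V W : normedModType C) :
    {pred (V -> W)} :=
  [pred f : V -> W |
    `[< linear f /\ exists M : C, forall x, `|f x| <= M * `|x| >]].

Lemma bounded_linear_submod_closed (C : numFieldType) (V W : normedModType C) :
  submod_closed (@bounded_linear C V W).
Proof.
split=> [|c f g /asboolP[lf [M fM]] /asboolP[lg [N gN]]]; apply/asboolP.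
  split=> [a x y|]; first by rewrite scaler0 addr0.
  by exists 0 => x; rewrite normr0 mul0r.
split=> [a x y|].
  rewrite !fctE lf lg !scalerDr !scalerA [c * a]mulrC -!addrA; congr (_ + _).
  by rewrite addrCA.
exists (`|c| * M + N) => x; rewrite mulrDl -mulrA.
by rewrite (le_trans (ler_normD _ _))// lerD// normrZ ler_wpM2l.
Qed.

HB.instance Definition _ (C : numFieldType) (V W : normedModType C) :=
  GRing.isSubmodClosed.Build C (V -> W) (@bounded_linear C V W)
    (@bounded_linear_submod_closed C V W).

Record bop (C : numFieldType) (V W : normedModType C) := Bop {
  bop_fun :> V -> W ;
  bop_bounded_linear : bop_fun \in @bounded_linear C V W
}.

HB.instance Definition _ (C : numFieldType) (V W : normedModType C) :=
  [isSub for @bop_fun C V W].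
HB.instance Definition _ (C : numFieldType) (V W : normedModType C) :=
  [Choice of bop V W by <:].
HB.instance Definition _ (C : numFieldType) (V W : normedModType C) :=
  [SubChoice_isSubLmodule of bop V W by <:].

Section opnorm.
Context {R : realType} {V W : normedModType (Cplx R)}.
Implicit Types f g : bop V W.

Definition opnorm f : Cplx R :=
  (sup [set complex.Re `|f x| | x in [set x : V | `|x| <= 1]])%:C%C.

Lemma bop_linear f : linear f.
Proof. by have /asboolP[] := bop_bounded_linear f. Qed.

Lemma bop0 f : f 0 = 0.
Proof. by have := bop_linear f (-1) 0 0; rewrite scaler0 addr0 scaleN1r addNr. Qed.

Lemma bopZ f (c : Cplx R) x : f (c *: x) = c *: f x.
Proof. by have := bop_linear f c x 0; rewrite bop0 !addr0. Qed.

Lemma Cplx_ReK (z : Cplx R) : 0 <= z -> (complex.Re z)%:C%C = z :> Cplx R.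
Proof. by move=> z0; apply: RRe_real; apply: ger0_real. Qed.

Lemma Re_le (y z : Cplx R) : y <= z -> complex.Re y <= complex.Re z.
Proof. by case: y z => [a b] [c d]; rewrite lecE => /andP[]. Qed.

Lemma opnorm_has_sup f :
  has_sup [set complex.Re `|f x| | x in [set x : V | `|x| <= 1]].
Proof.
split; first by exists (complex.Re `|f 0|), 0 => //=; rewrite normr0.
have /asboolP[_ [M fM]] := bop_bounded_linear f.
exists (complex.Re `|M|) => _ [x x1 <-]; apply: Re_le; rewrite /= in x1.
rewrite (le_trans (real_ler_norm _))// normr_id.
have [x0|x0] := eqVneq x 0; first by rewrite x0 bop0 normr0.
have xgt0 : 0 < `|x| by rewrite normr_gt0.
have M0 : 0 <= M by rewrite -(pmulr_lge0 _ xgt0) (le_trans _ (fM x)).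
by rewrite (le_trans (fM x))// ger0_norm// ler_piMr.
Qed.

Lemma opnorm_ge0 f : 0 <= opnorm f.
Proof.
rewrite lecR; apply: le_trans (ub_le_sup (opnorm_has_sup f).2 _); last first.
  by exists 0 => //=; rewrite normr0.
by rewrite bop0 normr0.
Qed.

Lemma opnormP f x : `|f x| <= opnorm f * `|x|.
Proof.
have [->|x0] := eqVneq x 0; first by rewrite bop0 !normr0 mulr0.
have xgt0 : 0 < `|x| by rewrite normr_gt0.
rewrite -ler_pdivrMr// -[X in _ / X](normr_id x) -normfV.
rewrite mulrC -normrZ -bopZ -[leLHS]Cplx_ReK// lecR.
apply: (ub_le_sup (opnorm_has_sup f).2); exists (`|x|^-1 *: x) => //=.
by rewrite normrZ normfV normr_id mulVf ?gt_eqF.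
Qed.

Lemma opnorm_le f (M : Cplx R) :
  0 <= M -> (forall x, `|f x| <= M * `|x|) -> opnorm f <= M.
Proof.
move=> M0 fM; rewrite -(Cplx_ReK M0) lecR.
apply: ge_sup; first exact: (opnorm_has_sup f).1.
move=> _ [x x1 <-]; apply: Re_le; rewrite (le_trans (fM x))//.
by rewrite ler_piMr.
Qed.

Lemma opnormD f g : opnorm (f + g) <= opnorm f + opnorm g.
Proof.
apply: opnorm_le => [|x]; first by rewrite addr_ge0 ?opnorm_ge0.
by rewrite mulrDl (le_trans (ler_normD _ _))// lerD// opnormP.
Qed.

Lemma opnormZ (c : Cplx R) f : opnorm (c *: f) = `|c| * opnorm f.
Proof.
have le (d : Cplx R) g : opnorm (d *: g) <= `|d| * opnorm g.
  apply: opnorm_le => [|x]; first by rewrite mulr_ge0 ?opnorm_ge0.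
  by rewrite [X in `|X|]/(d *: g x) normrZ -mulrA ler_wpM2l// opnormP.
apply/eqP; rewrite eq_le le/=; have [->|c0] := eqVneq c 0.
  by rewrite normr0 mul0r opnorm_ge0.
rewrite -ler_pdivlMl ?normr_gt0// -normfV.
by rewrite -[in leLHS](scalerK c0 f) le.
Qed.

Lemma opnorm_eq0 f : opnorm f = 0 -> f = 0.
Proof.
move=> f0; apply/val_inj/funext => x; apply/eqP; rewrite -normr_le0.
by rewrite (le_trans (opnormP f x))// f0 mul0r.
Qed.

HB.instance Definition _ :=
  Lmodule_isNormed.Build (Cplx R) (bop V W) opnormD opnormZ opnorm_eq0.

End opnorm.

(* M_n^d; in finite dimension the choice of norm is immaterial. *)
Definition mtuple (R : realType) (d n : nat) : Type :=
  l2sum d 'M[Cplx R]_n.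

HB.instance Definition _ (R : realType) (d n : nat) :=
  NormedModule.copy (mtuple R d n) (l2sum d 'M[Cplx R]_n).

(* M^d, the disjoint union of the M_n^d over n >= 1: an element of first
   component n is a d-tuple of matrices of size n.+1. *)
Definition mspace (R : realType) (d : nat) : Type :=
  {n : nat & mtuple R d n.+1}.

Definition level (R : realType) (d : nat) (l : mspace R d) : nat :=
  (projT1 l).+1.

(* The part E_(n.+1) of E. *)
Definition slice (R : realType) (d : nat) (E : set (mspace R d)) (n : nat) :
    set (mtuple R d n.+1) :=
  [set x | E (existT _ n x)].
Arguments slice {R d} E n _.

Definition finitely_open (R : realType) (d : nat) (E : set (mspace R d)) :=
  forall n, open (slice E n).

Definition finitely_compact (R : realType) (d : nat) (K : set (mspace R d)) :=
  (forall n, compact (slice K n)) /\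
  (exists N, forall n, (N <= n)%N -> slice K n = set0).

(* B(C^n, C^n (x) H) with the operator norm. The tensor product C^n (x) H is
   the l^2-sum of n copies of H, e_i (x) h being h placed in position i. *)
Definition tensor_op (R : realType) (H : normedModType (Cplx R)) (n : nat) :
    normedModType (Cplx R) :=
  bop (l2sum n (Cplx R)) (l2sum n H).

(* Graded functions; their values off the domain of interest are irrelevant. *)
Definition graded_fun (R : realType) (d : nat) (H : normedModType (Cplx R)) :
    Type :=
  forall l : mspace R d, tensor_op H (level l).

Section Hol.
Context {R : realType} {d : nat} {H : hilbertType (Cplx R)}.
Implicit Types (Omega : set (mspace R d)) (f : graded_fun d H).
Implicit Types (u : nat -> graded_fun d H) (lam : nat -> mspace R d).

Definition restrict_level f (n : nat) (x : mtuple R d n.+1) :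
    tensor_op H n.+1 :=
  f (existT _ n x).
Arguments restrict_level f n x : clear implicits.

(* On the open sets Omega_n, holomorphic means complex (Frechet)
   differentiable at every point, the scalar field being C. *)
Definition Hol Omega : set (graded_fun d H) :=
  [set f | forall n (x : mtuple R d n.+1),
     slice Omega n x -> differentiable (restrict_level f n) x].

Definition cvg_in_Hol Omega u (v : graded_fun d H) :=
  forall K : set (mspace R d), finitely_compact K -> K `<=` Omega ->
  forall eps : Cplx R, 0 < eps ->
  \forall k \near \oo, forall l, K l -> `|u k l - v l| < eps.

Definition finitely_locally_uniformly_bounded Omega u :=
  forall l, Omega l ->
  exists B : set (mspace R d),
    [/\ finitely_open B, B l, B `<=` Omega &
        exists M : Cplx R, forall k m, B m -> `|u k m| <= M].

End Hol.

Definition set_of_uniqueness (R : realType) (d : nat)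
    (H : hilbertType (Cplx R)) (Omega : set (mspace R d))
    (lam : nat -> mspace R d) :=
  forall f : graded_fun d H, Hol Omega f ->
  (forall i, f (lam i) = 0) -> forall l, Omega l -> f l = 0.

(* Main.v *)
(* A Vitali argument that avoids compactness of bounded subsets of the (possibly
   infinite-dimensional) target. Goursat's theorem on squares yields Cauchy
   estimates f(x + h) - f(x) - f'(x)h = O(M |h|^2 / r^2) for functions bounded
   by M on a ball of radius r, first for scalar functions of one variable, then,
   by restriction to complex lines and composition with matrix coefficients, for
   operator-valued ones. These estimates survive pointwise limits along any
   filter. Were (u^k) not pointwise Cauchy at some point, composing differences
   of its terms with suitable matrix coefficients and taking an ultralimit would
   produce a scalar holomorphic function vanishing at all the lambda_i but not
   at that point; multiplied by a fixed operator it contradicts uniqueness.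
   Hence u^k converges pointwise; the limit is holomorphic and, by
   equicontinuity, the convergence is locally uniform. *)
From HB Require Import structures.
Require Import Defs.
From mathcomp Require Import all_boot all_order all_algebra sesquilinear
  complex.
From mathcomp Require Import ring lra.
From mathcomp Require Import all_classical all_reals all_analysis.

Set Implicit Arguments.
Unset Strict Implicit.
Unset Printing Implicit Defensive.

Import Order.TTheory GRing.Theory Num.Theory.
Import numFieldNormedType.Exports.

Local Open Scope classical_set_scope.
Local Open Scope ring_scope.

(** * Frechet differentiability *)

(** When [H] is infinite-dimensional, bounded sequences of operators need not have norm-convergent
    subsequences, and a weak limit of differences whose norms stay away from 0 may still be 0. A
    single functional therefore cannot be expected to detect divergence at a point: the functional
    has to vary with the index, and only the resulting complex numbers, bounded because the
    functionals are contractive, are sent to a limit. That limit is a scalar function, while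
    uniqueness is assumed for operator-valued ones; the factor that bridges the gap has to be a
    nonzero operator. Differentiability of the limits is read off from remainder bounds that are
    uniform over all functions with the same radius and the same bound, which is why the Cauchy
    estimates are kept quantitative. Squares are convenient contours because their sides turn
    contour integrals into Lebesgue integrals over real segments. *)

Lemma lt_min_pos (K : numDomainType) (x y : K) : 0 < x -> 0 < y ->
  exists2 r : K, 0 < r & forall z, z < r -> z < x /\ z < y.
Proof.
(* The order of the complex field is partial; two radii have a minimum because positive elements are
   real, hence comparable. *)
move=> x0 y0; have xy : (x >=< y)%O by apply: real_comparable; exact: gtr0_real.
exists (Num.min x y) => [|z]; first by rewrite comparable_lt_min// x0.
by rewrite comparable_lt_min// => /andP.
Qed.

Section frechet.
Context {K : numFieldType} {V W : normedModType K}.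
Implicit Types (f : V -> W) (x : V).

Lemma differentiable_eps f x : differentiable f x ->
  forall e : K, 0 < e -> exists2 r : K, 0 < r &
    forall h, `|h| < r -> `|f (x + h) - f x - 'd f x h| <= e * `|h|.
Proof.
move=> fx e e0; have /eqaddoP/(_ e e0)/nbhs_normP[r r0 rP] := diff_locally fx.
exists r => // h hr; have /= := rP h.
rewrite /= sub0r normrN => /(_ hr).
by rewrite !fctE/= opprD addrA [h + x]addrC.
Qed.

Lemma lipschitz_linear_continuous (L : {linear V -> W}) (k : K) :
  0 <= k -> (forall h, `|L h| <= k * `|h|) -> continuous L.
Proof.
move=> k0 Lk; apply: bounded_linear_continuous.
apply/linear_boundedP; near=> r => y.
apply: le_trans (Lk y) _; rewrite ler_wpM2r//; near: r.
by apply: nbhs_pinfty_ge; exact: ger0_real.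
Unshelve. all: by end_near. Qed.

(** The bound [k] is what makes [L] continuous, and a continuous linear map with a little-o
    remainder is the differential. All differentials below are identified in this way. *)
Lemma differentiable_linear_eps f x (L : {linear V -> W}) (k : K) :
  0 <= k -> (forall h, `|L h| <= k * `|h|) ->
  (forall e : K, 0 < e -> exists2 r : K, 0 < r &
    forall h, `|h| < r -> `|f (x + h) - f x - L h| <= e * `|h|) ->
  differentiable f x /\ 'd f x = L :> (V -> W).
Proof.
move=> k0 Lk fL.
have cL := lipschitz_linear_continuous k0 Lk.
have E : f \o shift x = cst (f x) + L +o_ 0 id.
  apply/eqaddoP => e e0; have [r r0 rP] := fL e e0.
  apply/nbhs_normP; exists r => // h.
  rewrite /= sub0r normrN => /rP.
  by rewrite !fctE/= opprD addrA [h + x]addrC.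
have dL := diff_unique cL E; split => //.
by apply/diff_locallyP; rewrite dL.
Qed.

End frechet.

Lemma cvg_norm_le (K : numFieldType) (V : normedModType K) (T : Type)
    (F : set_system T) (FF : ProperFilter F) (u : T -> V) (l : V) (c : K) :
  u @ F --> l -> (\forall t \near F, `|u t| <= c) -> `|l| <= c.
Proof.
move=> /cvgrPdist_lt ul uc; apply/ler_addgt0Pr => e e0.
have [t [/ltW ut ct]] := filter_ex (filterI (ul e e0) uc).
rewrite -[l](subrK (u t)) (le_trans (ler_normD _ _))// addrC.
exact: lerD.
Qed.

Lemma near_dist_lt (K : numFieldType) (V : normedModType K) (x : V) (s : K) :
  0 < s -> \forall y \near x, `|y - x| < s.
Proof. by move=> s0; apply/nbhs_normP; exists s => // y; rewrite /= distrC. Qed.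

(** * Complex-valued integrals over a segment *)

Section complex_facts.
Context {R : realType}.
Local Notation C := (Cplx R).
Local Notation Re := (@complex.Re R).
Local Notation Im := (@complex.Im R).
Local Notation cplx := (fun x y : R => (x +i* y)%C : C).

Lemma normCE (z : C) : `|z| = (Num.sqrt (Re z ^+ 2 + Im z ^+ 2))%:C%C.
Proof. by case: z. Qed.

Lemma Re_norm_le (z : C) : `|Re z|%:C%C <= `|z|.
Proof.
by rewrite normCE lecR -sqrtr_sqr ler_wsqrtr// lerDl sqr_ge0.
Qed.

Lemma Im_norm_le (z : C) : `|Im z|%:C%C <= `|z|.
Proof.
by rewrite normCE lecR -sqrtr_sqr ler_wsqrtr// lerDr sqr_ge0.
Qed.

Lemma norm_le_ReIm (z : C) : `|z| <= (`|Re z| + `|Im z|)%:C%C.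
Proof.
rewrite normCE lecR -[leRHS]ger0_norm ?addr_ge0// -sqrtr_sqr ler_wsqrtr//.
rewrite sqrrD !real_normK ?num_real// addrAC lerDl.
by rewrite mulrn_wge0// mulr_ge0.
Qed.

Lemma Re_continuous : continuous (Re : C -> R).
Proof.
move=> z; apply/(@cvgrPdist_lt _ _ _ (nbhs z)) => e e0.
apply/nbhs_normP; exists e%:C%C => [|w /= zw]; first by rewrite /= ltcR.
by rewrite -ltcR -raddfB; apply: le_lt_trans zw; exact: Re_norm_le.
Qed.

Lemma Im_continuous : continuous (Im : C -> R).
Proof.
move=> z; apply/(@cvgrPdist_lt _ _ _ (nbhs z)) => e e0.
apply/nbhs_normP; exists e%:C%C => [|w /= zw]; first by rewrite /= ltcR.
by rewrite -ltcR -raddfB; apply: le_lt_trans zw; exact: Im_norm_le.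
Qed.

Lemma cplx_cvg (T : Type) (F : set_system T) (FF : Filter F) (f g : T -> R)
    (a b : R) :
  f @ F --> a -> g @ F --> b -> cplx (f x) (g x) @[x --> F] --> cplx a b.
Proof.
move=> /cvgrPdist_lt fa /cvgrPdist_lt gb; apply/cvgrPdist_lt => e e0.
have ek : (complex.Re e)%:C%C = e by exact/Cplx_ReK/ltW.
have k0 : 0 < complex.Re e / 2 by rewrite divr_gt0// -ltcR ek.
near=> x; apply: (le_lt_trans (norm_le_ReIm _)); rewrite -ek ltcR/=.
rewrite (splitr (complex.Re e)) ltrD//; near: x; [exact: fa|exact: gb].
Unshelve. all: by end_near. Qed.

End complex_facts.

Section complex_integral.
Context {R : realType}.
Local Notation C := (Cplx R).
Local Notation Re := (@complex.Re R).
Local Notation Im := (@complex.Im R).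
Local Notation mu := (@lebesgue_measure R).
Implicit Types (a b c : R) (F G : R -> C).

Definition cint a b F : C :=
  ((\int[mu]_(x in `[a, b]) Re (F x)) +i* (\int[mu]_(x in `[a, b]) Im (F x)))%C.

(** Continuity is two-sided even at the endpoints. This is natural here: the integrands come from
    functions on the plane that are continuous at every point of a side. *)
Definition continuous_on a b F :=
  forall x, a <= x <= b -> {for x, continuous F}.

Lemma integrable_continuous_on a b (f : R -> R) :
  (forall x, a <= x <= b -> {for x, continuous f}) ->
  mu.-integrable `[a, b] (EFin \o f).
Proof.
move=> cf; apply: continuous_compact_integrable; first exact: segment_compact.
by apply: continuous_in_subspaceT => x; rewrite inE/= in_itv/=; exact: cf.
Qed.

Lemma integrable_Re a b F : continuous_on a b F ->
  mu.-integrable `[a, b] (EFin \o (fun x => Re (F x))).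
Proof.
move=> cF; apply: integrable_continuous_on => x /cF cFx.
by apply: continuous_comp => //; exact: Re_continuous.
Qed.

Lemma integrable_Im a b F : continuous_on a b F ->
  mu.-integrable `[a, b] (EFin \o (fun x => Im (F x))).
Proof.
move=> cF; apply: integrable_continuous_on => x /cF cFx.
by apply: continuous_comp => //; exact: Im_continuous.
Qed.

Lemma eq_cint a b F G : (forall x, a <= x <= b -> F x = G x) ->
  cint a b F = cint a b G.
Proof.
by move=> FG; congr Complex; apply: eq_Rintegral => x;
  rewrite inE/= in_itv/= => /FG ->.
Qed.

Lemma cintD a b F G : continuous_on a b F -> continuous_on a b G ->
  cint a b (fun x => F x + G x) = cint a b F + cint a b G.
Proof.
move=> cF cG; rewrite /cint; under eq_Rintegral do rewrite raddfD.
rewrite RintegralD//; [|exact: integrable_Re..].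
under [X in (_ +i* X)%C]eq_Rintegral do rewrite raddfD.
by rewrite RintegralD//; exact: integrable_Im.
Qed.

Lemma cintZ a b (k : C) F : continuous_on a b F ->
  cint a b (fun x => k * F x) = k * cint a b F.
Proof.
case: k => r s cF; rewrite /cint.
have iR := integrable_Re cF; have iI := integrable_Im cF.
have iZ t f : mu.-integrable `[a, b] (EFin \o f) ->
    mu.-integrable `[a, b] (EFin \o (fun x => t * f x)).
  move=> fi; have := @integrableZl _ _ _ mu _ (measurable_itv _) t _ fi. exact.
rewrite [RHS]/GRing.mul/=.
congr Complex.
  transitivity (\int[mu]_(x in `[a, b]) (r * Re (F x) - s * Im (F x))).
    by apply: eq_Rintegral => x _; case: (F x).
  by rewrite RintegralB ?RintegralZl//; exact: iZ.
transitivity (\int[mu]_(x in `[a, b]) (r * Im (F x) + s * Re (F x))).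
  by apply: eq_Rintegral => x _; case: (F x).
by rewrite RintegralD ?RintegralZl//; exact: iZ.
Qed.

Lemma cint_split a b c F : a <= b -> b <= c -> continuous_on a c F ->
  cint a c F = cint a b F + cint b c F.
Proof.
move=> ab bc cF.
have E (f : R -> R) : mu.-integrable `[a, c] (EFin \o f) ->
    \int[mu]_(x in `[a, c]) f x =
    \int[mu]_(x in `[a, b]) f x + \int[mu]_(x in `[b, c]) f x.
  move=> fi; apply/eqP; rewrite addrC -subr_eq; apply/eqP.
  rewrite Rintegral_itvB// -Rintegral_itv_obnd_cbnd//.
  by apply: integrableS fi => //; apply: subset_itvr.
by rewrite /cint (E _ (integrable_Re cF)) (E _ (integrable_Im cF)).
Qed.

(** The factor 2 is the price of estimating the real and imaginary parts separately with the real
    triangle inequality for integrals. *)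
Lemma cint_near a b F (K eta : C) : a <= b -> continuous_on a b F ->
  (forall x, a <= x <= b -> `|F x - K| <= eta) ->
  `|cint a b F - (b - a)%:C%C * K| <= 2%:R * (b - a)%:C%C * eta.
Proof.
move=> ab cF FK.
have eta0 : 0 <= eta by apply: le_trans (FK a _); rewrite ?lexx.
have E (f : R -> R) k : mu.-integrable `[a, b] (EFin \o f) ->
    (forall x, a <= x <= b -> `|f x - k| <= Re eta) ->
    `|\int[mu]_(x in `[a, b]) f x - (b - a) * k| <= (b - a) * Re eta.
  move=> fi fk.
  have ic l : mu.-integrable `[a, b] (EFin \o cst l).
    by apply: integrable_continuous_on => x _; exact: cst_continuous.
  have Ec l : \int[mu]_(x in `[a, b]) l = (b - a) * l.
    by rewrite Rintegral_cst// [X in fine X]lebesgue_measure_itv/= lte_fin;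
      case: ltgtP ab
      => //= [_ _|-> _]; rewrite ?subrr ?mulr0 ?mul0r// mulrC.
  rewrite -!Ec -RintegralB//; last exact: ic.
  have ifk : mu.-integrable `[a, b] (EFin \o (fun x => f x - k)).
    by have := @integrableB _ _ _ mu _ (measurable_itv _) _ _ fi (ic k).
  apply: le_trans (le_normr_Rintegral _ ifk) _; first exact: measurable_itv.
  apply: le_Rintegral (ic _) _ => //; first exact: integrable_norm ifk.
have etaE : (Re eta)%:C%C = eta by exact: Cplx_ReK.
have {}FK x : a <= x <= b ->
    `|Re (F x) - Re K| <= Re eta /\ `|Im (F x) - Im K| <= Re eta.
  move=> /FK; rewrite -etaE => Fx; rewrite -!raddfB -!lecR.
  by split; apply: le_trans Fx; [exact: Re_norm_le|exact: Im_norm_le].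
apply: le_trans (norm_le_ReIm _) _.
have -> : 2%:R * (b - a)%:C%C * eta =
    ((b - a) * Re eta + (b - a) * Re eta)%:C%C.
  by rewrite -[in LHS]etaE -mulrA mulr_natl -rmorphM -raddfMn mulr2n.
rewrite lecR; apply: lerD.
  have -> : Re (cint a b F - (b - a)%:C%C * K) =
      \int[mu]_(x in `[a, b]) Re (F x) - (b - a) * Re K.
    by case: K {FK} => k l; rewrite raddfB/= mul0r subr0.
  by apply: E => [|x /FK[]//]; exact: integrable_Re.
have -> : Im (cint a b F - (b - a)%:C%C * K) =
    \int[mu]_(x in `[a, b]) Im (F x) - (b - a) * Im K.
  by case: K {FK} => k l; rewrite raddfB/= mul0r addr0.
by apply: E => [|x /FK[]//]; exact: integrable_Im.
Qed.

End complex_integral.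

(** * Goursat's theorem *)

Section goursat.
Context {R : realType}.
Local Notation C := (Cplx R).
Local Notation Re := (@complex.Re R).
Local Notation Im := (@complex.Im R).
Local Notation pt := (fun x y : R => (x +i* y)%C : C).
Implicit Types (a b c d x y : R) (f : C -> C).

Definition rect a b c d : set C := [set z | a <= Re z <= b /\ c <= Im z <= d].

Definition rect_bd a b c d : set C := [set z | rect a b c d z /\
  [\/ Re z = a, Re z = b, Im z = c | Im z = d]].

(** The counterclockwise contour integral of f dz, with opposite sides merged into one integrand: dz
    is dx on the horizontal sides and i dy on the vertical ones. *)
Definition rint a b c d f : C :=
  cint a b (fun x => f (pt x c) - f (pt x d)) +
  'i%C * cint c d (fun y => f (pt b y) - f (pt a y)).

Lemma continuous_on_side1 a b c f :
  (forall x, a <= x <= b -> {for pt x c, continuous f}) ->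
  continuous_on a b (fun x => f (pt x c)).
Proof.
move=> cf x /cf cfx.
have cpt : (fun t => pt t c : C) @ x --> (pt x c : C).
  by apply: cplx_cvg; [exact: cvg_id|exact: cvg_cst].
exact: (@continuous_comp _ _ _ (fun t => pt t c : C) f x cpt cfx).
Qed.

Lemma continuous_on_side2 a b c f :
  (forall y, a <= y <= b -> {for pt c y, continuous f}) ->
  continuous_on a b (fun y => f (pt c y)).
Proof.
move=> cf x /cf cfx.
have cpt : (fun t => pt c t : C) @ x --> (pt c x : C).
  by apply: cplx_cvg; [exact: cvg_cst|exact: cvg_id].
exact: (@continuous_comp _ _ _ (fun t => pt c t : C) f x cpt cfx).
Qed.

Lemma continuous_onB a b (F G : R -> C) : continuous_on a b F ->
  continuous_on a b G -> continuous_on a b (fun x => F x - G x).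
Proof. by move=> cF cG x ab; apply: cvgB; [exact: cF|exact: cG]. Qed.

(** The side shared by the two halves is traversed in opposite directions, so its contributions
    telescope. *)
Lemma rint_vsplit a e b c d f : a <= e -> e <= b -> c <= d ->
  (forall z, rect a b c d z -> {for z, continuous f}) ->
  rint a b c d f = rint a e c d f + rint e b c d f.
Proof.
move=> ae eb cd cf.
have ab := le_trans ae eb.
have cside x : a <= x <= b -> continuous_on c d (fun y => f (pt x y)).
  by move=> xab; apply: continuous_on_side2 => y yd; apply: cf; split.
rewrite /rint (cint_split ae eb); last first.
  by apply: continuous_onB; apply: continuous_on_side1 => x xab; apply: cf;
    split => //=; rewrite lexx cd.
rewrite addrACA; congr (_ + _); rewrite -mulrDr -cintD; last 2 first.
- by apply: continuous_onB; apply: cside; rewrite ?lexx ?ab ?ae ?eb.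
- by apply: continuous_onB; apply: cside; rewrite ?lexx ?ab ?ae ?eb.
by congr (_ * _); apply: eq_cint => y _; rewrite [RHS]addrC subrKA.
Qed.

Lemma rint_hsplit a b c e d f : a <= b -> c <= e -> e <= d ->
  (forall z, rect a b c d z -> {for z, continuous f}) ->
  rint a b c d f = rint a b c e f + rint a b e d f.
Proof.
move=> ab ce ed cf.
have cd := le_trans ce ed.
have cside y : c <= y <= d -> continuous_on a b (fun x => f (pt x y)).
  by move=> ycd; apply: continuous_on_side1 => x xd; apply: cf; split.
rewrite /rint (cint_split ce ed); last first.
  by apply: continuous_onB; apply: continuous_on_side2 => y ycd; apply: cf;
    split => //=; rewrite lexx ab.
rewrite mulrDr addrACA; congr (_ + _); rewrite -cintD; last 2 first.
- by apply: continuous_onB; apply: cside; rewrite ?lexx ?cd ?ce ?ed.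
- by apply: continuous_onB; apply: cside; rewrite ?lexx ?cd ?ce ?ed.
by apply: eq_cint => x _; rewrite subrKA.
Qed.

Lemma rect_bd_sides a b c d : a <= b -> c <= d ->
  (forall x, a <= x <= b ->
     rect_bd a b c d (pt x c) /\ rect_bd a b c d (pt x d)) /\
  (forall y, c <= y <= d ->
     rect_bd a b c d (pt a y) /\ rect_bd a b c d (pt b y)).
Proof.
move=> ab cd; split=> t tI; split;
  (split; first by split => //=; rewrite ?lexx ?ab ?cd);
  by [constructor 1|constructor 2|constructor 3|constructor 4].
Qed.

Lemma rint_continuous a b c d f : a <= b -> c <= d ->
  (forall z, rect_bd a b c d z -> {for z, continuous f}) ->
  [/\ continuous_on a b (fun x => f (pt x c)),
      continuous_on a b (fun x => f (pt x d)),
      continuous_on c d (fun y => f (pt a y)) &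
      continuous_on c d (fun y => f (pt b y))].
Proof.
move=> ab cd cf; have [bd1 bd2] := rect_bd_sides ab cd.
split; [apply: continuous_on_side1|apply: continuous_on_side1|
  apply: continuous_on_side2|apply: continuous_on_side2] => t tI; apply: cf.
- by case: (bd1 t tI).
- by case: (bd1 t tI).
- by case: (bd2 t tI).
- by case: (bd2 t tI).
Qed.

(* The two integrands of an affine function are constant and their
   contributions cancel. *)
Lemma rint_near_affine a b c d f (k l eta : C) : a <= b -> c <= d ->
  (forall z, rect_bd a b c d z -> {for z, continuous f}) ->
  (forall z, rect_bd a b c d z -> `|f z - (k + l * z)| <= eta) ->
  `|rint a b c d f| <= 4%:R * ((b - a) + (d - c))%:C%C * eta.
Proof.
move=> ab cd cf fkl.
have [bd1 bd2] := rect_bd_sides ab cd.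
pose K1 : C := l * 'i%C * (c - d)%:C%C; pose K2 : C := l * (b - a)%:C%C.
have E1 : `|cint a b (fun x => f (pt x c) - f (pt x d)) - (b - a)%:C%C * K1|
    <= 2%:R * (b - a)%:C%C * (eta + eta).
  apply: cint_near => //.
    by apply: continuous_onB; apply: continuous_on_side1 => x xab; apply: cf;
      case: (bd1 x xab).
  move=> x xab.
  have -> : f (pt x c) - f (pt x d) - K1 =
     (f (pt x c) - (k + l * pt x c)) - (f (pt x d) - (k + l * pt x d)).
    have -> : K1 = l * (pt x c - pt x d).
      rewrite /K1 -mulrA; congr (_ * _).
      by apply/eqP; rewrite eq_complex/=; apply/andP; split; apply/eqP; ring.
    ring.
  by apply: le_trans (ler_normB _ _) _; apply: lerD; apply: fkl;
    case: (bd1 x xab).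
have E2 : `|cint c d (fun y => f (pt b y) - f (pt a y)) - (d - c)%:C%C * K2|
    <= 2%:R * (d - c)%:C%C * (eta + eta).
  apply: cint_near => //.
    by apply: continuous_onB; apply: continuous_on_side2 => y ycd; apply: cf;
      case: (bd2 y ycd).
  move=> y ycd.
  have -> : f (pt b y) - f (pt a y) - K2 =
     (f (pt b y) - (k + l * pt b y)) - (f (pt a y) - (k + l * pt a y)).
    have -> : K2 = l * (pt b y - pt a y).
      rewrite /K2; congr (_ * _).
      by apply/eqP; rewrite eq_complex/=; apply/andP; split; apply/eqP; ring.
    ring.
  by apply: le_trans (ler_normB _ _) _; apply: lerD; apply: fkl;
    case: (bd2 y ycd).
rewrite /rint; move: E1 E2; set I1 := cint _ _ _; set I2 := cint _ _ _ => E1 E2.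
have -> : I1 + 'i%C * I2 =
    (I1 - (b - a)%:C%C * K1) + 'i%C * (I2 - (d - c)%:C%C * K2).
  have -> : (b - a)%:C%C * K1 = - ('i%C * ((d - c)%:C%C * K2)).
    by rewrite /K1 /K2 -[c - d]opprB raddfN; ring.
  by ring.
apply: le_trans (ler_normD _ _) _; rewrite normrM.
have -> : `|'i%C : C| = 1 by rewrite normCE/= expr0n expr1n add0r sqrtr1.
(* Each integrand joins two sides, hence deviates by [eta + eta]; with the factor 2 of [cint_near]
   this gives the 4. *)
rewrite mul1r (le_trans (lerD E1 E2))// raddfD/= le_eqVlt; apply/orP; left.
by apply/eqP; ring.
Qed.

Lemma eq_rint a b c d f g : a <= b -> c <= d ->
  (forall z, rect_bd a b c d z -> f z = g z) ->
  rint a b c d f = rint a b c d g.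
Proof.
move=> ab cd fg; have [bd1 bd2] := rect_bd_sides ab cd.
congr (_ + _ * _); apply: eq_cint => t tI.
  by have [? ?] := bd1 t tI; rewrite !fg.
by have [? ?] := bd2 t tI; rewrite !fg.
Qed.

Lemma rintD a b c d f g : a <= b -> c <= d ->
  (forall z, rect_bd a b c d z -> {for z, continuous f}) ->
  (forall z, rect_bd a b c d z -> {for z, continuous g}) ->
  rint a b c d (fun z => f z + g z) = rint a b c d f + rint a b c d g.
Proof.
move=> ab cd /(rint_continuous ab cd)[f1 f2 f3 f4].
move=> /(rint_continuous ab cd)[g1 g2 g3 g4].
have [f12 f34] := (continuous_onB f1 f2, continuous_onB f4 f3).
have [g12 g34] := (continuous_onB g1 g2, continuous_onB g4 g3).
rewrite /rint addrACA -mulrDr -(cintD f12 g12) -(cintD f34 g34).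
by congr (_ + _ * _); apply: eq_cint => t _; ring.
Qed.

Lemma rintZ a b c d (k : C) f : a <= b -> c <= d ->
  (forall z, rect_bd a b c d z -> {for z, continuous f}) ->
  rint a b c d (fun z => k * f z) = k * rint a b c d f.
Proof.
move=> ab cd /(rint_continuous ab cd)[f1 f2 f3 f4].
have [f12 f34] := (continuous_onB f1 f2, continuous_onB f4 f3).
rewrite /rint mulrDr mulrCA -(cintZ k f12) -(cintZ k f34).
by congr (_ + _ * _); apply: eq_cint => t _; ring.
Qed.

Lemma rint_le a b c d f (eta : C) : a <= b -> c <= d ->
  (forall z, rect_bd a b c d z -> {for z, continuous f}) ->
  (forall z, rect_bd a b c d z -> `|f z| <= eta) ->
  `|rint a b c d f| <= 4%:R * ((b - a) + (d - c))%:C%C * eta.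
Proof.
move=> ab cd cf fe; apply: (@rint_near_affine _ _ _ _ _ 0 0) => // z /fe.
by rewrite mul0r addr0 subr0.
Qed.

End goursat.

Section goursat_theorem.
Context {R : realType}.
Local Notation C := (Cplx R).
Local Notation Re := (@complex.Re R).
Local Notation Im := (@complex.Im R).
Implicit Types (a b c d x y w h : R) (f : C -> C).

Lemma rect_sub a b c d a' b' c' d' : a <= a' -> b' <= b -> c <= c' -> d' <= d ->
  rect a' b' c' d' `<=` rect a b c d.
Proof.
move=> aa bb cc dd z [/andP[z1 z2] /andP[z3 z4]]; split; apply/andP; split.
- exact: le_trans z1.
- exact: le_trans bb.
- exact: le_trans z3.
- exact: le_trans dd.
Qed.

Lemma rint_quarter x y w h f : 0 <= w -> 0 <= h ->
  (forall z, rect x (x + w) y (y + h) z -> {for z, continuous f}) ->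
  exists p : R * R, [/\ x <= p.1, p.1 + w / 2 <= x + w,
    y <= p.2, p.2 + h / 2 <= y + h &
    `|rint x (x + w) y (y + h) f| <=
    4%:R * `|rint p.1 (p.1 + w / 2) p.2 (p.2 + h / 2) f| ].
Proof.
move=> w0 h0 cf; pose m := x + w / 2; pose n := y + h / 2.
have mE : m + w / 2 = x + w by rewrite /m; field.
have nE : n + h / 2 = y + h by rewrite /n; field.
have xm : x <= m by rewrite lerDl divr_ge0.
have mx : m <= x + w by rewrite -mE lerDl divr_ge0.
have yn : y <= n by rewrite lerDl divr_ge0.
have ny : n <= y + h by rewrite -nE lerDl divr_ge0.
pose q u v := rint u (u + w / 2) v (v + h / 2) f.
have QE : rint x (x + w) y (y + h) f = q x y + q x n + (q m y + q m n).
  rewrite (rint_vsplit xm mx) ?(le_trans yn ny)//.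
  rewrite (rint_hsplit xm yn ny); last first.
    by move=> z /(rect_sub (lexx _) mx (lexx _) (lexx _)); exact: cf.
  rewrite (rint_hsplit mx yn ny); last first.
    by move=> z /(rect_sub xm (lexx _) (lexx _) (lexx _)); exact: cf.
  by rewrite /q mE nE.
(* If all four quarters failed the bound, adding the four strict inequalities would make 4 times the
   norm of the whole integral smaller than itself. *)
apply: contrapT => H.
have {}H u v : x <= u -> u + w / 2 <= x + w -> y <= v -> v + h / 2 <= y + h ->
    4%:R * `|q u v| < `|rint x (x + w) y (y + h) f|.
  move=> *; rewrite real_ltNge ?realM ?normr_real ?realn//.
  by apply/negP => ?; apply: H; exists (u, v); split.
have : 4%:R * `|rint x (x + w) y (y + h) f| <
    4%:R * `|rint x (x + w) y (y + h) f|.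
  rewrite {1}QE; apply: (@le_lt_trans _ _ (4%:R * `|q x y| + 4%:R * `|q x n| +
      (4%:R * `|q m y| + 4%:R * `|q m n|))).
    rewrite -!mulrDr ler_wpM2l//; apply: le_trans (ler_normD _ _) _.
    by apply: lerD; exact: ler_normD.
  have -> : 4%:R * `|rint x (x + w) y (y + h) f| =
     (`|rint x (x + w) y (y + h) f| + `|rint x (x + w) y (y + h) f|) +
     (`|rint x (x + w) y (y + h) f| + `|rint x (x + w) y (y + h) f|) by ring.
  by apply: ltrD; apply: ltrD; apply: H; rewrite ?mE ?nE ?lexx.
by rewrite ltxx.
Qed.

Lemma nested_rects (f : C -> C) x y w h : 0 <= w -> 0 <= h ->
  (forall z, rect x (x + w) y (y + h) z -> {for z, continuous f}) ->
  exists z0 : C, forall n : nat, exists p : R * R,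
    let w' := w / 2 ^+ n in let h' := h / 2 ^+ n in
    [/\ x <= p.1 /\ p.1 + w' <= x + w, y <= p.2 /\ p.2 + h' <= y + h,
        rect p.1 (p.1 + w') p.2 (p.2 + h') z0 &
        `|rint x (x + w) y (y + h) f| <=
        4%:R ^+ n * `|rint p.1 (p.1 + w') p.2 (p.2 + h') f| ].
Proof.
move=> w0 h0 cf.
pose W n : R := w / 2 ^+ n; pose H n : R := h / 2 ^+ n.
have W0 n : 0 <= W n by rewrite divr_ge0// exprn_ge0.
have H0 n : 0 <= H n by rewrite divr_ge0// exprn_ge0.
have WS n : W n.+1 = W n / 2 by rewrite /W exprSr invfM mulrA.
have HS n : H n.+1 = H n / 2 by rewrite /H exprSr invfM mulrA.
pose inside n (p : R * R) := [/\ x <= p.1, p.1 + W n <= x + w, y <= p.2 &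
  p.2 + H n <= y + h].
pose r n (p : R * R) := rint p.1 (p.1 + W n) p.2 (p.2 + H n) f.
pose refines n (p p' : R * R) := [/\ p.1 <= p'.1, p'.1 + W n.+1 <= p.1 + W n,
  p.2 <= p'.2, p'.2 + H n.+1 <= p.2 + H n & `|r n p| <= 4%:R * `|r n.+1 p'| ].
(* The guard [inside] makes the refinement step total, so that a choice function exists before any
   corner is known to lie in the rectangle. *)
have step np : exists p', inside np.1 np.2 -> refines np.1 np.2 p'.
  case: np => n p /=; case: (pselect (inside n p)) => [[i1 i2 i3 i4]|];
    last by exists p.
  have [|p' [? ? ? ? ?]] := @rint_quarter p.1 p.2 (W n) (H n) f (W0 n) (H0 n).
    by move=> z /(rect_sub i1 i2 i3 i4); exact: cf.
  by exists p'; rewrite /refines /r WS HS; split.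
have [next nextP] := choice step.
pose s := fix s n := if n is m.+1 then next (m, s m) else (x, y).
have sin n : inside n (s n) /\
    `|rint x (x + w) y (y + h) f| <= 4%:R ^+ n * `|r n (s n)|.
  elim: n => [|n [IH IHr]].
    by rewrite /inside /r /W /H/= expr0 !divr1 mul1r !lexx.
  have [? ? ? ? rS] := nextP (n, s n) IH; case: IH => ? ? ? ?; split.
    split => /=; [exact: (le_trans _ (_ : (s n).1 <= _))|
      exact: (le_trans (_ : _ <= (s n).1 + W n))|
      exact: (le_trans _ (_ : (s n).2 <= _))|
      exact: (le_trans (_ : _ <= (s n).2 + H n))].
  by apply: le_trans IHr _; rewrite exprSr -mulrA ler_wpM2l// exprn_ge0.
have sref n : refines n (s n) (s n.+1).
  by apply: (nextP (n, s n)); exact: (sin n).1.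
(* Nested segments, given by left end [u n] and length [v n]: every left end lies below every right
   end, so the supremum of the left ends lies in all of them. It is applied to each coordinate. *)
have mono (u v : nat -> R) : (forall n, u n <= u n.+1) ->
    (forall n, u n.+1 + v n.+1 <= u n + v n) -> (forall n, 0 <= v n) ->
    exists l, forall n, u n <= l <= u n + v n.
  move=> uS vS v0.
  have ule m n : (m <= n)%N -> u m <= u n.
    by move=> /subnK <-; elim: (n - m)%N => // k /le_trans; apply; exact: uS.
  have vle m n : (m <= n)%N -> u n + v n <= u m + v m.
    by move=> /subnK <-; elim: (n - m)%N => // k; apply: le_trans; exact: vS.
  have uv m n : u m <= u n + v n.
    have [mn|nm] := leqP m n; first by rewrite (le_trans (ule _ _ mn))// lerDl.
    by rewrite (le_trans _ (vle _ _ (ltnW nm)))// lerDl.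
  exists (sup (range u)) => n; apply/andP; split.
    apply: ub_le_sup; last by exists n.
    by exists (u 0 + v 0) => _ [m _ <-].
  by apply: ge_sup => [|_ [m _ <-]//]; exists (u 0), 0.
have [l1 l1P] : exists l, forall n, (s n).1 <= l <= (s n).1 + W n.
  by apply: mono => // n; case: (sref n).
have [l2 l2P] : exists l, forall n, (s n).2 <= l <= (s n).2 + H n.
  by apply: mono => // n; case: (sref n).
exists (l1 +i* l2)%C => n; exists (s n); have [[? ? ? ?] ?] := sin n.
by split.
Qed.

Lemma goursat_rect a b c d f : a <= b -> c <= d ->
  (forall z, rect a b c d z -> differentiable f z) -> rint a b c d f = 0.
Proof.
move=> ab cd df.
have cf z : rect a b c d z -> {for z, continuous f}.
  by move=> /df; exact: differentiable_continuous.
have [w0 h0] : 0 <= b - a /\ 0 <= d - c by rewrite !subr_ge0.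
pose s := (b - a) + (d - c).
have s0 : 0 <= s by rewrite addr_ge0.
have [bE dE] : a + (b - a) = b /\ c + (d - c) = d by split; rewrite addrC subrK.
have [|z0 z0P] := @nested_rects f a c (b - a) (d - c) w0 h0.
  by rewrite bE dE.
rewrite bE dE in z0P.
have dz0 : differentiable f z0.
  by have [p] := z0P 0; rewrite /= => -[[? ?] [? ?] z0p _]; apply: df;
    apply: rect_sub z0p.
apply/eqP; rewrite -normr_le0; apply/ler_addgt0Pl => e e0; rewrite addr0.
(* At stage n the bound will be 4^n * 4 * (s / 2^n) * e' * (s / 2^n) = 4 * s^2 * e', independent of
   n. Using s + 1 instead of s keeps the quotient meaningful for a degenerate rectangle. *)
pose e' : C := e / (4%:R * (s + 1)%:C%C ^+ 2).
have s10 : 0 < (s + 1)%:C%C :> C by rewrite ltcR ltr_wpDl.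
have e'0 : 0 < e' by rewrite divr_gt0// mulr_gt0// exprn_gt0.
have [r r0 rP] := differentiable_eps dz0 e'0.
have rE : (Re r)%:C%C = r by exact/Cplx_ReK/ltW.
have [n nr] : exists n, s / 2 ^+ n < Re r.
  have Rr0 : 0 < Re r by rewrite -ltcR rE.
  exists (Num.bound (s / Re r)); set n := Num.bound _.
  have : s / Re r < n%:R by apply: archi_boundP; rewrite divr_ge0// ltW.
  rewrite ltr_pdivrMr// => sn; rewrite ltr_pdivrMr ?exprn_gt0//.
  apply: lt_le_trans sn _; rewrite mulrC ler_pM2l// -natrX ler_nat.
  exact/ltnW/ltn_expl.
have [[p1 p2]] := z0P n; rewrite /=.
set w := (b - a) / _; set h := (d - c) / _.
move=> [[ap pb] [cp pd] z0p le_n]; apply: le_trans le_n _.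
have whE : w + h = s / 2 ^+ n by rewrite -mulrDl.
have w'0 : 0 <= w by rewrite divr_ge0// exprn_ge0.
have h'0 : 0 <= h by rewrite divr_ge0// exprn_ge0.
pose l := 'd f z0 (1 : C).
have diffE t : 'd f z0 t = t * l.
  by rewrite -[t in LHS]mulr1 -[t * 1]/(t *: (1 : C)) linearZ.
(* The comparison function is the tangent map at [z0]. Points of the small rectangle are within
   [w + h] of [z0], so its error there is at most [e' * (w + h)]. *)
have := @rint_near_affine _ p1 (p1 + w) p2 (p2 + h) f (f z0 - l * z0) l
  (e' * (w + h)%:C%C).
have -> : p1 + w - p1 + (p2 + h - p2) = w + h by ring.
move=> near_aff.
have : `|rint p1 (p1 + w) p2 (p2 + h) f| <=
    4%:R * (w + h)%:C%C * (e' * (w + h)%:C%C).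
  apply: near_aff; rewrite ?lexx ?lerDl//.
    by move=> z [zp _]; apply: cf; exact: (rect_sub ap pb cp pd zp).
  move=> z [zp _].
  have zz0 : `|z - z0| <= (w + h)%:C%C.
    apply: le_trans (norm_le_ReIm _) _; rewrite lecR !raddfB/=.
    case: zp z0p => /andP[? ?] /andP[? ?] [/andP[? ?] /andP[? ?]].
    by apply: lerD; rewrite ler_norml; apply/andP; split; lra.
  have := rP (z - z0); rewrite (addrC z0) subrK diffE => H.
  have -> : f z - (f z0 - l * z0 + l * z) = f z - f z0 - (z - z0) * l by ring.
  apply: le_trans (H _) _; last by rewrite ler_wpM2l// ltW.
  by apply: le_lt_trans zz0 _; rewrite -rE ltcR whE.
move=> /(ler_wpM2l (_ : 0 <= 4%:R ^+ n)) => /(_ (exprn_ge0 _ (ler0n _ _))) H.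
apply: le_trans H _; rewrite whE.
have -> : 4%:R ^+ n * (4%:R * (s / 2 ^+ n)%:C%C * (e' * (s / 2 ^+ n)%:C%C)) =
    e * (s%:C%C ^+ 2 / (s + 1)%:C%C ^+ 2).
  rewrite /e'; set S := (s + 1)%:C%C.
  have -> : (s / 2 ^+ n)%:C%C = s%:C%C / 2%:R ^+ n :> C.
    by rewrite rmorphM/= fmorphV rmorphXn rmorph_nat.
  have -> : 4%:R ^+ n = 2%:R ^+ n * 2%:R ^+ n :> C.
    by rewrite -exprMn -natrM.
  have : 2%:R ^+ n != 0 :> C by rewrite expf_neq0// pnatr_eq0.
  have : S != 0 by rewrite gt_eqF.
  by move: S (2%:R ^+ n) => S T S1 T1; field; rewrite S1 T1.
rewrite ler_piMr ?(ltW e0)// ler_pdivrMr ?exprn_gt0// mul1r.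
have S0 : 0 <= s%:C%C :> C by rewrite lecR.
have S1 : s%:C%C <= (s + 1)%:C%C :> C by rewrite lecR lerDl.
by rewrite lerXn2r ?nnegrE// ltW.
Qed.

End goursat_theorem.

(** * Cauchy estimates *)

Section cauchy_estimate.
Context {R : realType}.
Local Notation C := (Cplx R).
Local Notation Re := (@complex.Re R).
Local Notation Im := (@complex.Im R).
Local Notation pt := (fun x y : R => (x +i* y)%C : C).
Implicit Types (a b c d : R) (f phi : C -> C) (w z M : C).

(** Cutting along the sides of the small square leaves four outer rectangles that miss the
    exceptional point, and [goursat_rect] annihilates each of them. *)
Lemma rint_shrink a b c d p q r f : 0 < r ->
  a <= p - r -> p + r <= b -> c <= q - r -> q + r <= d ->
  (forall z, rect a b c d z -> {for z, continuous f}) ->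
  (forall z, rect a b c d z -> z != pt p q -> differentiable f z) ->
  rint a b c d f = rint (p - r) (p + r) (q - r) (q + r) f.
Proof.
move=> r0 ap pb cq qd cf df.
have pp : p - r <= p + r by lra.
have qq : q - r <= q + r by lra.
have cd : c <= d by lra.
have sub a' b' c' d' : a <= a' -> b' <= b -> c <= c' -> d' <= d ->
    forall z, rect a' b' c' d' z -> {for z, continuous f}.
  by move=> ? ? ? ? z zr; apply: cf; apply: rect_sub zr.
have out a' b' c' d' : a <= a' -> b' <= b -> c <= c' -> d' <= d ->
    a' <= b' -> c' <= d' -> ~ rect a' b' c' d' (pt p q) ->
    rint a' b' c' d' f = 0.
  move=> ? ? ? ? ? ? pq; apply: goursat_rect => // z zr.
  apply: df; first by apply: rect_sub zr.
  by apply/eqP => zE; apply: pq; rewrite -zE.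
have [pb' qd'] : p - r <= b /\ q - r <= d by split; lra.
rewrite (rint_vsplit ap pb' cd cf).
rewrite [X in X + _]out ?add0r//; last by case=> /=; lra.
rewrite (rint_vsplit pp pb cd); last exact: sub.
rewrite [X in _ + X]out ?addr0//; [|lra|by case=> /=; lra].
rewrite (rint_hsplit pp cq qd'); last exact: sub.
rewrite [X in X + _]out ?add0r//; last by case=> /=; lra.
rewrite (rint_hsplit pp qq qd); last exact: sub.
by rewrite [X in _ + X]out ?addr0//; [lra|case=> /=; lra].
Qed.

Lemma goursat_punctured a b c d p q f : a < p < b -> c < q < d ->
  (forall z, rect a b c d z -> {for z, continuous f}) ->
  (forall z, rect a b c d z -> z != pt p q -> differentiable f z) ->
  rint a b c d f = 0.
Proof.
move=> /andP[ap pb] /andP[cq qd] cf df.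
have cfw : {for pt p q, continuous f} by apply: cf; split => /=; lra.
have [s s0 sP] : exists2 s : C, 0 < s &
    forall z, `|pt p q - z| < s -> `|f z| <= `|f (pt p q)| + 1.
  have /(@cvgrPdist_lt _ _ _ (nbhs (pt p q)))/(_ 1 ltr01)/nbhs_normP[s s0 sP]
    := cfw.
  exists s => // z /sP /= zs; rewrite -lerBlDl.
  by apply: le_trans (ltW zs); rewrite distrC lerB_dist.
have sE : (Re s)%:C%C = s by exact/Cplx_ReK/ltW.
have Rs0 : 0 < Re s by rewrite -ltcR sE.
apply/eqP; rewrite -normr_le0; apply/ler_addgt0Pl => e e0; rewrite addr0.
set B : C := `|f (pt p q)| + 1 in sP.
have B0 : 0 < B by rewrite ltr_wpDl.
have eE : (Re (e / B))%:C%C = e / B by apply/Cplx_ReK/ltW; rewrite divr_gt0.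
have k0 : 0 < Re (e / B) by rewrite -ltcR eE divr_gt0.
(* The first four terms keep the square inside the rectangle. [Re s / 4] keeps it where f is bounded
   by [B], as r + r < s. The last makes the integral, at most 4 * (2r + 2r) * B = 16 * r * B, no
   larger than e. *)
pose r := Num.min (Num.min (p - a) (b - p)) (Num.min (Num.min (q - c) (d - q))
  (Num.min (Re s / 4) (Re (e / B) / 16))).
have r0 : 0 < r by rewrite !lt_min !subr_gt0 ap pb cq qd !divr_gt0.
have := lexx r; rewrite {2}/r !le_min.
move=> /andP[/andP[r1 r2] /andP[/andP[r3 r4] /andP[r5 r6]]].
have [ap' pb' cq' qd'] : [/\ a <= p - r, p + r <= b, c <= q - r & q + r <= d].
  by split; lra.
have rr : p - r <= p + r /\ q - r <= q + r by split; lra.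
rewrite (rint_shrink r0 ap' pb' cq' qd' cf df).
apply: le_trans (@rint_le _ _ _ _ _ _ B rr.1 rr.2 _ _) _.
- by move=> z [zr _]; apply: cf; exact: (rect_sub ap' pb' cq' qd' zr).
- move=> z [zr _]; apply: sP; rewrite -sE.
  apply: le_lt_trans (norm_le_ReIm _) _; rewrite ltcR !raddfB/=.
  case: zr => /andP[? ?] /andP[? ?].
  apply: (@le_lt_trans _ _ (r + r)); last by lra.
  by apply: lerD; rewrite ler_norml; lra.
rewrite -ler_pdivlMr// -eE.
have -> : p + r - (p - r) + (q + r - (q - r)) = 4%:R * r by ring.
by rewrite -(rmorph_nat (real_complex R)) -rmorphM lecR; lra.
Qed.


Local Notation oint := (rint (-1) 1 (-1) 1).
Local Notation bd := (rect_bd (-1 : R) 1 (-1) 1).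

(** The combined integrands are 2i / (1 + x^2) and 2 / (1 + y^2). On [-1, 1] the quotient 2 / (1 +
    t^2) stays within 1/2 of 3/2, so the contour integral is within 4 of 6i. *)
Lemma oint_inv_neq0 : 2%:R <= `|oint (fun z => z^-1)|.
Proof.
have N11 : -1 <= 1 :> R by lra.
have bd0 z : bd z -> z != 0.
  move=> [_ zbd]; apply/eqP => z0; move: zbd; rewrite z0/=.
  by case; lra.
have cinv z : bd z -> {for z, continuous (fun z : C => z^-1)}.
  by move=> /bd0 z0; exact: inv_continuous.
have [c1 c2 c3 c4] := rint_continuous N11 N11 cinv.
have bnd t : -1 <= t <= 1 -> `|2 / (1 + t ^+ 2) - 3 / 2| <= 1 / 2 :> R.
  move=> /andP[t1 t2]; have t0 : 0 < 1 + t ^+ 2 by rewrite ltr_pwDl// sqr_ge0.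
  rewrite ler_norml; apply/andP; split.
    by rewrite lerBrDr ler_pdivlMr//; nra.
  by rewrite lerBlDr ler_pdivrMr//; nra.
have E1 : `|cint (-1) 1 (fun x => (pt x (-1))^-1 - (pt x 1)^-1) -
    (1 - -1)%:C%C * pt 0 (3 / 2)| <= 2%:R * (1 - -1)%:C%C * (1 / 2)%:C%C.
  apply: (cint_near N11 (continuous_onB c1 c2)) => x /bnd xb;
    apply: le_trans (norm_le_ReIm _) _; rewrite lecR.
  have x0 : x ^+ 2 + 1 != 0 by rewrite gt_eqF// ltr_wpDl// sqr_ge0.
  suff -> : (pt x (-1))^-1 - (pt x 1)^-1 - pt 0 (3 / 2) =
    pt 0 (2 / (1 + x ^+ 2) - 3 / 2) by rewrite /= normr0 add0r.
  by apply/eqP; rewrite eq_complex/=; apply/andP; split; apply/eqP; field;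
    rewrite ?[1 + _]addrC x0.
have E2 : `|cint (-1) 1 (fun y => (pt 1 y)^-1 - (pt (-1) y)^-1) -
    (1 - -1)%:C%C * pt (3 / 2) 0| <= 2%:R * (1 - -1)%:C%C * (1 / 2)%:C%C.
  apply: (cint_near N11 (continuous_onB c4 c3)) => y /bnd yb.
  apply: le_trans (norm_le_ReIm _) _; rewrite lecR.
  have y0 : 1 + y ^+ 2 != 0 by rewrite gt_eqF// ltr_pwDl// sqr_ge0.
  suff -> : (pt 1 y)^-1 - (pt (-1) y)^-1 - pt (3 / 2) 0 =
    pt (2 / (1 + y ^+ 2) - 3 / 2) 0 by rewrite /= normr0 addr0.
  by apply/eqP; rewrite eq_complex/=; apply/andP; split; apply/eqP; field;
    rewrite y0.
rewrite /rint; move: E1 E2; set I1 := cint _ _ _; set I2 := cint _ _ _ => E1 E2.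
have E : `|6%:R * 'i%C - (I1 + 'i%C * I2)| <= 4%:R :> C.
  have -> : 6%:R * 'i%C - (I1 + 'i%C * I2) =
      - (I1 - (1 - -1)%:C%C * pt 0 (3 / 2)) +
      - ('i%C * (I2 - (1 - -1)%:C%C * pt (3 / 2) 0)) :> C.
    have -> : pt 0 (3 / 2) = 'i%C * pt (3 / 2) 0.
      by apply/eqP; rewrite eq_complex/=; apply/andP; split; apply/eqP; ring.
    have -> : 6%:R = 2%:R * (1 - -1)%:C%C * pt (3 / 2) 0 :> C.
      rewrite -[pt _ _]/((3 / 2)%:C%C) -(rmorph_nat (real_complex R)).
      rewrite -[2%:R](rmorph_nat (real_complex R)) -!rmorphM; congr (_%:C)%C.
      by field.
    ring.
  apply: le_trans (ler_normD _ _) _; rewrite !normrN normrM.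
  have -> : `|'i%C : C| = 1 by rewrite normCE/= expr0n expr1n add0r sqrtr1.
  rewrite mul1r (le_trans (lerD E1 E2))//.
  rewrite -!(rmorph_nat (real_complex R)) -!rmorphM -rmorphD lecR; lra.
have i6 : `|6%:R * 'i%C : C| = 6%:R.
  by rewrite normrM normr_nat normCE/= expr0n expr1n add0r sqrtr1 mulr1.
have := le_trans (lerB_dist _ _) E; rewrite i6 lerBlDr -lerBlDl.
by apply: le_trans; rewrite -natrB.
Qed.


End cauchy_estimate.

Section cauchy_estimate_disc.
Context {R : realType}.
Local Notation C := (Cplx R).
Local Notation Re := (@complex.Re R).
Local Notation Im := (@complex.Im R).
Local Notation oint := (rint (-1 : R) 1 (-1) 1).
Local Notation bd := (rect_bd (-1 : R) 1 (-1) 1).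
Local Notation square := (rect (-1 : R) 1 (-1) 1).
Implicit Types (phi : C -> C) (w z M : C).

Lemma bd_norm_ge1 z : bd z -> 1 <= `|z|.
Proof.
have H (t : R) (y : C) : `|t|%:C%C <= `|y| -> t = 1 \/ t = -1 -> 1 <= `|y|.
  by move=> ty t1; apply: le_trans ty; rewrite lecR; case: t1 => ->;
    rewrite ?normrN normr1.
have HR := H _ _ (Re_norm_le z); have HI := H _ _ (Im_norm_le z).
by case=> _ [] E; by [apply: HR; rewrite E; auto|apply: HI; rewrite E; auto].
Qed.

Definition dquot phi w z : C :=
  if z == w then 'd phi w 1 else (phi z - phi w) / (z - w).

Lemma dquot_differentiable phi w z : z != w -> differentiable phi z ->
  differentiable (dquot phi w) z.
Proof.
move=> zw dphi.
have dq : differentiable (fun t : C => (phi t - phi w) * (t - w)^-1) z.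
  apply: differentiableM; first exact: differentiableB.
  by apply: differentiableV; [exact: differentiableB|rewrite subr_eq0].
apply/derivable1_diffP; move/derivable1_diffP: dq.
apply: near_eq_derivable.
apply/nbhs_normP; exists `|z - w|; first by rewrite /= normr_gt0 subr_eq0.
move=> t /= zt; rewrite /dquot; case: eqVneq => // tw.
by rewrite tw ltxx in zt.
Qed.

Lemma diff_scalar phi w t : 'd phi w t = t * 'd phi w (1 : C).
Proof. by rewrite -[t in LHS]mulr1 -[t * 1]/(t *: (1 : C)) linearZ. Qed.

Lemma dquot_continuous phi w : differentiable phi w ->
  {for w, continuous (dquot phi w)}.
Proof.
move=> dphi; apply/(@cvgrPdist_lt _ _ _ (nbhs w)) => e e0.
have e20 : 0 < e / 2%:R by rewrite divr_gt0.
have [r r0 rP] := differentiable_eps dphi e20.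
apply/nbhs_normP; exists r => //= z /=; rewrite distrC => zw.
rewrite /dquot eqxx; case: eqVneq => [_|zw0]; first by rewrite subrr normr0.
have := rP _ zw; rewrite (addrC w) subrK (diff_scalar _ _ (z - w)) => H.
rewrite distrC; apply: (@le_lt_trans _ _ (e / 2%:R)); last first.
  by rewrite ltr_pdivrMr// mulr_natr mulr2n ltrDl.
have zw1 : z - w != 0 by rewrite subr_eq0.
have zwn : 0 < `|z - w| by rewrite normr_gt0.
rewrite -(ler_pM2r zwn) -normrM mulrBl divfK//.
by rewrite [_ * (z - w)]mulrC.
Qed.

(* Cauchy's formula on the square is obtained in the form
   [oint (dquot phi w) = 0] and expanded with
   1/(z - w) = 1/z + w/z^2 + w^2/(z^2 (z - w)).
   Of [oint (1/z)] only a lower bound on the norm is needed, not the value. *)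
Lemma cauchy_estimate : exists2 K : C, 0 <= K & forall phi M,
  (forall z, square z -> differentiable phi z) ->
  (forall z, square z -> `|phi z| <= M) ->
  forall w, `|w| <= 2%:R^-1 ->
  `|phi w - phi 0 - 'd phi 0 w| <= K * (M * `|w| ^+ 2).
Proof.
(* With |psi| <= 2M, the bound 16 * eta for boundary integrals gives |B| <= 32M, |k1| <= 16 and 64M
   for the remainder. Dividing by |k0| >= 2, the linear bound has 48 = (32 + 32 + 32) / 2 and the
   quadratic one 416 = (64 + 48 * 16) / 2. *)
exists 416%:R; first exact: ler0n.
move=> phi M dphi Mphi.
have N11 : -1 <= 1 :> R by lra.
have sq0 : square 0 by split => /=; lra.
have M0 : 0 <= M := le_trans (normr_ge0 _) (Mphi _ sq0).
have half0 : 0 < 2%:R^-1 :> C by rewrite invr_gt0.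
have half1 : 2%:R^-1 < 1 :> C by rewrite invf_lt1// ltr1n.
have wpunct w : `|w| <= 2%:R^-1 -> -1 < Re w < 1 /\ -1 < Im w < 1.
  move=> w2; have := le_lt_trans w2 half1 => w1.
  have : `|Re w| < 1 by rewrite -ltcR (le_lt_trans (Re_norm_le _)).
  have : `|Im w| < 1 by rewrite -ltcR (le_lt_trans (Im_norm_le _)).
  by rewrite !ltr_norml.
have wsq w : `|w| <= 2%:R^-1 -> square w.
  by move=> /wpunct[/andP[? ?] /andP[? ?]]; split; apply/andP; split;
    exact: ltW.
have cauchy0 w : `|w| <= 2%:R^-1 -> oint (dquot phi w) = 0.
  move=> w2; have [Rw Iw] := wpunct w w2.
  apply: (goursat_punctured Rw Iw) => z sz.
    have [->|zw] := eqVneq z w.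
      by apply: dquot_continuous; apply: dphi; exact: wsq.
    by apply: differentiable_continuous; apply: dquot_differentiable => //;
      exact: dphi.
  move=> zw; apply: dquot_differentiable; last exact: dphi.
  by move: zw; case: (w).
have bdsq z : bd z -> square z by case.
have bd0 z : bd z -> z != 0.
  by move=> /bd_norm_ge1 z1; rewrite -normr_gt0 (lt_le_trans ltr01).
have bdw w z : `|w| <= 2%:R^-1 -> bd z -> 2%:R^-1 <= `|z - w| /\ z != w.
  move=> w2 /bd_norm_ge1 z1.
  suff H : 2%:R^-1 <= `|z - w|.
    by split=> //; rewrite -subr_eq0 -normr_gt0 (lt_le_trans half0).
  apply: le_trans (lerB_dist _ _); rewrite lerBrDr (le_trans _ z1)//.
  by rewrite (le_trans (lerD (lexx _) w2))// -mulr2n -[_ *+ _]mulr_natr mulVf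
    ?pnatr_eq0.
have contd (f : C -> C) : (forall z, bd z -> differentiable f z) ->
    forall z, bd z -> {for z, continuous f}.
  by move=> df z /df; exact: differentiable_continuous.
have oD (f g : C -> C) : (forall z, bd z -> differentiable f z) ->
    (forall z, bd z -> differentiable g z) ->
    oint (fun z => f z + g z) = oint f + oint g.
  by move=> /contd cf /contd cg; exact: rintD.
have oZ (k : C) (f : C -> C) : (forall z, bd z -> differentiable f z) ->
    oint (fun z => k * f z) = k * oint f.
  by move=> /contd cf; exact: rintZ.
have ole (f : C -> C) (eta : C) : (forall z, bd z -> differentiable f z) ->
    (forall z, bd z -> `|f z| <= eta) -> `|oint f| <= 16%:R * eta.
  move=> /contd cf fe; apply: le_trans (rint_le N11 N11 cf fe) _.
  have -> : 4%:R * (1 - -1 + (1 - -1))%:C%C = 16%:R :> C.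
    by rewrite -!(rmorph_nat (real_complex R)) -rmorphM; congr (_%:C)%C; ring.
  by [].
have dZ (k : C) (f : C -> C) z : differentiable f z ->
  differentiable (fun t => k * f t) z.
  by move=> df; apply: differentiableM.
have dD (f g : C -> C) z : differentiable f z -> differentiable g z ->
  differentiable (fun t => f t + g t) z.
  by move=> df dg; apply: differentiableD.
have dM (f g : C -> C) z : differentiable f z -> differentiable g z ->
  differentiable (fun t => f t * g t) z.
  by move=> df dg; apply: differentiableM.
have dV (f : C -> C) z : differentiable f z -> f z != 0 ->
  differentiable (fun t => (f t)^-1) z.
  by move=> df fz; apply: differentiableV.
have dId z : differentiable (fun t : C => t) z by [].
have dB (k : C) (f : C -> C) z : differentiable f z ->
  differentiable (fun t => f t - k) z.
  by move=> df; apply: differentiableB.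
pose psi z := phi z - phi 0.
have dpsi z : bd z -> differentiable psi z by move=> /bdsq/dphi; exact: dB.
have dinv z : bd z -> differentiable (fun t : C => t^-1) z.
  by move=> /bd0 z0; exact: dV.
have dinv2 z : bd z -> differentiable (fun t : C => t^-1 * t^-1) z.
  by move=> /dinv dz; exact: dM.
pose B := oint (fun z => psi z * (z^-1 * z^-1)).
pose k0 := oint (fun z => z^-1).
pose k1 := oint (fun z => z^-1 * z^-1).
pose rem w z := (psi z - psi w) * ((z^-1 * z^-1) * (z - w)^-1).
have drem w : `|w| <= 2%:R^-1 -> forall z, bd z -> differentiable (rem w) z.
  move=> w2 z zb; apply/dM; first exact/dB/dpsi.
  apply/dM; first exact: dinv2.
  apply/dV; first exact: dB.
  by rewrite subr_eq0; case: (bdw _ _ w2 zb).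
have n2 z : bd z -> `|z^-1 * z^-1| <= 1.
  move=> zb; have z1 : `|z^-1| <= 1.
    by rewrite normfV invf_le1 ?bd_norm_ge1// normr_gt0 bd0.
  by rewrite normrM mulr_ile1.
have k1_le : `|k1| <= 16%:R.
  rewrite -[leRHS]mulr1; exact: ole.
have psi_le z : square z -> `|psi z| <= 2%:R * M.
  move=> sz; apply: le_trans (ler_normB _ _) _.
  by rewrite mulr_natl mulr2n lerD// Mphi.
have B_le : `|B| <= 16%:R * (2%:R * M).
  apply: ole => [z zb|z zb].
    by apply/dM; [exact: dpsi|exact: dinv2].
  rewrite normrM -[leRHS]mulr1 ler_pM//; [exact/psi_le/bdsq|exact: n2].
have rem_le w : `|w| <= 2%:R^-1 -> `|oint (rem w)| <= 16%:R * (2%:R * M * 2%:R).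
  move=> w2; apply: ole => [|z zb]; first exact: drem.
  rewrite normrM ler_pM//.
    have -> : psi z - psi w = phi z - phi w by rewrite /psi opprB addrA subrK.
    apply: le_trans (ler_normB _ _) _.
    by rewrite mulr_natl mulr2n lerD// Mphi//; [exact: bdsq|exact: wsq].
  rewrite normrM -[leRHS]mul1r ler_pM ?n2// normfV.
  have [zw _] := bdw _ _ w2 zb.
  by rewrite -[leRHS]invrK lef_pV2// posrE (lt_le_trans half0).
(* The term of order zero, the integral of psi(z) / z, is the integral of [dquot phi 0] and
   vanishes, so the expansion starts with [w * B]. *)
have key w : `|w| <= 2%:R^-1 ->
    k0 * psi w = w * B - psi w * w * k1 + w ^+ 2 * oint (rem w).
  move=> w2.
  have E0 : oint (fun z => psi z * z^-1) = 0.
    rewrite -[RHS](cauchy0 0) ?normr0 ?ltW//.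
    apply: eq_rint => // z /bd0 z0.
    by rewrite /dquot (negPf z0) subr0.
  have : oint (fun z => psi z * z^-1 + (w * (psi z * (z^-1 * z^-1)) +
     (- psi w * z^-1 + (- (psi w * w) * (z^-1 * z^-1) +
      w ^+ 2 * rem w z)))) = 0.
    rewrite -[RHS](cauchy0 w w2); apply: eq_rint => // z zb.
    have [_ zw] := bdw _ _ w2 zb; have z0 := bd0 _ zb.
    rewrite /dquot (negPf zw) /rem.
    have -> : phi z - phi w = psi z - psi w by rewrite /psi opprB addrA subrK.
    have zw0 : z - w != 0 by rewrite subr_eq0.
    by field; rewrite z0 zw0.
  have d1 z : bd z -> differentiable (fun z => psi z * z^-1) z.
    by move=> zb; apply/dM; [exact: dpsi|exact: dinv].
  have d2 z : bd z -> differentiable (fun z => psi z * (z^-1 * z^-1)) z.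
    by move=> zb; apply/dM; [exact: dpsi|exact: dinv2].
  have dr := drem w w2.
  rewrite oD; [|exact: d1|]; last first.
    move=> z zb; apply/dD; first exact/dZ/d2.
    apply/dD; first exact/dZ/dinv.
    by apply/dD; [exact/dZ/dinv2|exact/dZ/dr].
  rewrite oD; [|by move=> z zb; exact/dZ/d2|]; last first.
    move=> z zb; apply/dD; first exact/dZ/dinv.
    by apply/dD; [exact/dZ/dinv2|exact/dZ/dr].
  rewrite oD; [|by move=> z zb; exact/dZ/dinv|]; last first.
    by move=> z zb; apply/dD; [exact/dZ/dinv2|exact/dZ/dr].
  rewrite oD; [|by move=> z zb; exact/dZ/dinv2|by move=> z zb; exact/dZ/dr].
  rewrite E0 add0r (oZ w _ d2) (oZ _ _ dinv) (oZ _ _ dinv2) (oZ _ _ dr).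
  rewrite -/B -/k0 -/k1 => H; apply/eqP; rewrite -subr_eq0; apply/eqP.
  by rewrite -[RHS]oppr0 -[in RHS]H; ring.
have k02 : 2%:R <= `|k0| := oint_inv_neq0.
have k0n : k0 != 0 by rewrite -normr_gt0 (lt_le_trans _ k02).
(* A bootstrap: of [k1] only a bound is available, so [psi w * w * k1] is a priori linear in w. Once
   psi(w) is known to be O(|w|), this term becomes quadratic. *)
have psi_lin w : `|w| <= 2%:R^-1 -> `|psi w| <= 48%:R * M * `|w|.
  move=> w2; rewrite -(@ler_pM2l _ 2%:R)//.
  apply: (@le_trans _ _ (`|k0| * `|psi w|)); first exact: ler_wpM2r.
  rewrite -normrM (key w w2).
  apply: le_trans (ler_normD _ _) _; rewrite (normrM (w ^+ 2)) normrX.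
  apply: le_trans (lerD (ler_normB _ _) (lexx _)) _; rewrite !normrM.
  have -> : 2%:R * (48%:R * M * `|w|) = `|w| * (16%:R * (2%:R * M)) +
     2%:R * M * `|w| * 16%:R + `|w| * 2%:R^-1 * (16%:R * (2%:R * M * 2%:R)).
    by field.
  apply: lerD; first apply: lerD.
  - by rewrite ler_wpM2l.
  - rewrite ler_pM ?mulr_ge0// ler_wpM2r//.
    exact/psi_le/wsq.
  - by rewrite expr2 ler_pM ?mulr_ge0// ?rem_le// ler_wpM2l.
pose c := B / k0.
have psi_quad w : `|w| <= 2%:R^-1 -> `|psi w - c * w| <= 416%:R * M * `|w| ^+ 2.
  move=> w2; rewrite -(@ler_pM2l _ 2%:R)//.
  apply: (@le_trans _ _ (`|k0| * `|psi w - c * w|)); first exact: ler_wpM2r.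
  have kc : k0 * (c * w) = w * B by rewrite /c; field.
  have -> : `|k0| * `|psi w - c * w| =
      `|w ^+ 2 * oint (rem w) - psi w * w * k1|.
    by rewrite -normrM mulrBr (key w w2) kc; congr `|_|; ring.
  apply: le_trans (ler_normB _ _) _.
  rewrite (normrM (w ^+ 2)) normrX !normrM.
  have -> : 2%:R * (416%:R * M * `|w| ^+ 2) =
    `|w| ^+ 2 * (16%:R * (2%:R * M * 2%:R)) +
    48%:R * M * `|w| * `|w| * 16%:R by ring.
  apply: lerD; first by rewrite ler_wpM2l ?exprn_ge0// rem_le.
  by rewrite ler_pM ?mulr_ge0// ler_wpM2r// psi_lin.
(* The quadratic estimate itself shows that [c = B / k0] is the derivative at 0. The summand 1 in
   [A] makes it positive even when M = 0. *)
have [_ dE] : differentiable phi 0 /\ 'd phi 0 = ( *:%R c) :> (C -> C).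
  apply: (@differentiable_linear_eps _ _ _ phi 0 ( *:%R c) `|c|) => //.
    by move=> h; rewrite normrZ.
  move=> e e0; pose A := 416%:R * M + 1.
  have A0 : 0 < A.
    by apply: ltr_wpDl ltr01; exact: mulr_ge0 (ler0n _ _) M0.
  have [r r0 rP] := lt_min_pos half0 (divr_gt0 e0 A0).
  exists r => // h /rP[h2 hr].
  rewrite add0r; apply: le_trans (psi_quad _ (ltW h2)) _.
  rewrite expr2 mulrA ler_wpM2r//.
  apply: (@le_trans _ _ (A * `|h|)); first by apply: ler_wpM2r => //;
    rewrite lerDl ler01.
  by rewrite mulrC -ler_pdivlMr// ltW.
by move=> w w2; rewrite dE mulrA; exact: psi_quad.
Qed.

End cauchy_estimate_disc.

(** * Cauchy estimates for maps between normed spaces *)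

Section vector_cauchy.
Context {R : realType}.
Local Notation C := (Cplx R).
Context {X W : normedModType C}.
Implicit Types (f : X -> W) (x h : X) (M N r : C).

Definition contractive (l : {linear W -> C}) := forall w, `|l w| <= `|w|.

(** Explicit functionals in the role of Hahn-Banach: a scalar estimate valid for all of them becomes
    a norm estimate at the cost of the factor [N]. *)
Definition norming (L : set {linear W -> C}) N :=
  [/\ 0 <= N, forall l, L l -> contractive l &
      forall w (a : C), 0 <= a -> (forall l, L l -> `|l w| <= a) ->
        `|w| <= N * a].

Lemma differentiable_line f (l : {linear W -> C}) x h (t : C) :
  contractive l -> differentiable f (x + t *: h) ->
  differentiable (fun s : C => l (f (x + s *: h))) t /\
  'd (fun s : C => l (f (x + s *: h))) t =
    *:%R (l ('d f (x + t *: h) h)) :> (C -> C).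
Proof.
move=> lc df; set y := x + t *: h.
apply: (@differentiable_linear_eps _ _ _ _ t
  ( *:%R (l ('d f y h))) `|l ('d f y h)|) => //.
  by move=> s; rewrite normrZ.
move=> e e0; have h1 : 0 < `|h| + 1 by rewrite ltr_wpDl.
have [r r0 rP] := differentiable_eps df (divr_gt0 e0 h1).
exists (r / (`|h| + 1)); first exact: divr_gt0.
move=> s sr.
have sh : `|s *: h| < r.
  rewrite normrZ; apply: (@le_lt_trans _ _ (`|s| * (`|h| + 1))).
    by rewrite ler_wpM2l// lerDl.
  by rewrite -ltr_pdivlMr.
have := rP _ sh; rewrite -/y linearZ => H.
have -> : l (f (x + (t + s) *: h)) - l (f y) - l ('d f y h) *: s =
    l (f (y + s *: h) - f y - s *: 'd f y h).
  rewrite [RHS]linearB [in RHS]linearB [in RHS]linearZ/= scalerDl addrA.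
  by congr (_ - _); rewrite /GRing.scale/= mulrC.
apply: le_trans (lc _) _; apply: le_trans H _.
rewrite normrZ mulrCA [e * _]mulrC ler_wpM2l//.
by rewrite mulrAC ler_pdivrMr// ler_wpM2l ?(ltW e0)// lerDl.
Qed.

Lemma vector_cauchy (L : set {linear W -> C}) N : norming L N ->
  exists2 K : C, 0 <= K & forall f x r M, 0 < r ->
  (forall h, `|h| < r -> differentiable f (x + h)) ->
  (forall h, `|h| < r -> `|f (x + h)| <= M) ->
  forall h, `|h| <= r / 8%:R ->
  `|f (x + h) - f x - 'd f x h| <= K * (M * (`|h| / r) ^+ 2).
Proof.
move=> [N0 Lc LN]; have [K0 K00 K0P] := @cauchy_estimate R.
have N1 : 0 <= N * K0 by exact: mulr_ge0.
have c16 : 0 <= 4%:R ^+ 2 :> C by rewrite exprn_ge0.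
exists (N * K0 * 4%:R ^+ 2); first exact: mulr_ge0.
move=> f x r M r0 df fM h hr.
have M0 : 0 <= M by apply: le_trans (fM 0 _); rewrite ?normr0.
have [->|h0] := eqVneq h 0.
  rewrite linear0 subr0 addr0 subrr !normr0 mul0r expr0n/= !mulr0.
  exact: lexx.
have nh0 : 0 < `|h| by rewrite normr_gt0.
(* Write h = s e with |e| = r / 4. For t in the unit square |t| <= 2, so t e has norm at most r / 2
   < r; and |h| <= r / 8 becomes |s| <= 1/2, the range of [cauchy_estimate]. *)
pose s : C := 4%:R * `|h| / r.
have s0 : 0 < s by rewrite divr_gt0// mulr_gt0.
have sn0 : s != 0 by rewrite gt_eqF.
pose e := s^-1 *: h.
have he : h = s *: e by rewrite /e scalerA divff// scale1r.
have en : `|e| = r / 4%:R.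
  rewrite /e normrZ normfV gtr0_norm// /s.
  have := nh0; move: (`|h|) => n n0; field.
  by rewrite !gt_eqF.
have lt_r (t : C) : rect (-1) 1 (-1) 1 t -> `|t *: e| < r.
  move=> [/andP[t1 t2] /andP[t3 t4]].
  have t2' : `|t| <= 2%:R.
    apply: le_trans (norm_le_ReIm _) _;
      rewrite -(rmorph_nat (real_complex R)) lecR.
    by rewrite -[2%:R]/(1 + 1) lerD// ler_norml; apply/andP.
  rewrite normrZ en; apply: (@le_lt_trans _ _ (2%:R * (r / 4%:R))).
    by rewrite ler_wpM2r// ltW// divr_gt0.
  have -> : 2%:R * (r / 4%:R) = r / 2%:R by field.
  by rewrite ltr_pdivrMr// mulr_natr mulr2n ltrDl.
have -> : N * K0 * 4%:R ^+ 2 * (M * (`|h| / r) ^+ 2) = N * (K0 * (M * s ^+ 2)).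
  by rewrite /s; ring.
apply: LN => [|l Ll].
  by do 2 apply: mulr_ge0 => //; rewrite exprn_ge0// ltW.
pose phi t := l (f (x + t *: e)).
have sle : `|s| <= 2%:R^-1.
  rewrite gtr0_norm// /s ler_pdivrMr// [leRHS]mulrC -ler_pdivlMl//.
  by apply: le_trans hr _; rewrite le_eqVlt; apply/orP; left; apply/eqP; field.
have dphi t : rect (-1) 1 (-1) 1 t -> differentiable phi t.
  move=> /lt_r tr.
  by case: (@differentiable_line f l x e t (Lc l Ll) (df _ tr)).
have Mphi t : rect (-1) 1 (-1) 1 t -> `|phi t| <= M.
  by move=> /lt_r tr; apply: le_trans (Lc l Ll _) _; exact: fM.
have := K0P phi M dphi Mphi s sle.
have [] := @differentiable_line f l x e 0 (Lc l Ll) _.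
  by apply: df; rewrite scale0r normr0.
move=> _ ->; rewrite (gtr0_norm s0) /phi scale0r addr0 -he.
have -> : l ('d f x e) *: s = l ('d f x h).
  by rewrite [in RHS]he [in RHS]linearZ [in RHS]linearZ /GRing.scale/= mulrC.
by rewrite 2!(raddfB l).
Qed.

End vector_cauchy.

(** * Operators with values in a Hilbert space *)

Section l2sum_coordinates.
Context {C : numClosedFieldType} {V : normedModType C} (n : nat).
Implicit Types x : l2sum n V.

Lemma l2sum_coord_le x i : `|x i| <= `|x|.
Proof.
rewrite -[leRHS]/(l2norm x) -(@ler_pXn2r _ 2) ?nnegrE ?sqrtC_ge0 ?sum_sqr_ge0//.
rewrite sqrtCK (bigD1 i)//= lerDl; apply: sumr_ge0 => j _.
by rewrite exprn_ge0.
Qed.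

Lemma l2sum_norm_le x : `|x| <= \sum_(i < n) `|x i|.
Proof.
have S0 : 0 <= \sum_(i < n) `|x i| by apply: sumr_ge0.
rewrite -[leLHS]/(l2norm x) -(@ler_pXn2r _ 2) ?nnegrE ?sqrtC_ge0 ?sum_sqr_ge0//.
rewrite sqrtCK [leRHS]expr2 mulr_suml; apply: ler_sum => i _.
rewrite expr2 ler_wpM2l// (bigD1 i)//= lerDl; exact: sumr_ge0.
Qed.

End l2sum_coordinates.

Section hilbert_norming.
Context {R : realType}.
Local Notation C := (Cplx R).
Context {H : hilbertType C} (n : nat).
Implicit Types (u v : H) (A : tensor_op H n).

Lemma inner_contractive u v : `|v| <= 1 -> `|inner u v| <= `|u|.
Proof.
move=> v1; set d := inner u v.
have vv : inner v v <= 1 by rewrite innerE expr_le1.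
(* Cauchy-Schwarz without division: for this choice of coefficient the square expands to |u|^2 -
   |d|^2 - |d|^2 (1 - |v|^2), and |v| <= 1 disposes of the last term. *)
have : 0 <= inner (u - d *: v) (u - d *: v) by rewrite innerE exprn_ge0.
rewrite linearBl !linearBr/= !linearZl_LR/= !linearZr_LR/=.
have -> : inner v u = d^* by rewrite hermC expr0 mul1r.
rewrite !innerE in vv *; rewrite -/d.
have -> : `|u| ^+ 2 - d^* * d - (d * d^* - d^* *: (d * `|v| ^+ 2)) =
    (`|u| ^+ 2 - `|d| ^+ 2) - `|d| ^+ 2 * (1 - `|v| ^+ 2).
  by rewrite normCK /GRing.scale/=; ring.
rewrite subr_ge0 => H1; rewrite -(@ler_pXn2r _ 2) ?nnegrE// -subr_ge0.
by apply: le_trans H1; rewrite mulr_ge0 ?exprn_ge0// subr_ge0.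
Qed.

Definition matrix_coef (x : l2sum n C) (i : 'I_n) (v : H) A : C :=
  inner (A x i) v.

Lemma matrix_coef_linear x i v : linear (matrix_coef x i v).
Proof.
move=> c A B; rewrite /matrix_coef.
have -> : (c *: A + B) x i = c *: A x i + B x i.
  by rewrite [_ x]/(c *: A x + B x) !ffunE.
by rewrite linearDl/= linearZl_LR.
Qed.

HB.instance Definition _ x i v := GRing.isLinear.Build C (tensor_op H n) C _
  (matrix_coef x i v) (matrix_coef_linear x i v).

Definition matrix_coefs : set {linear tensor_op H n -> C} :=
  [set l | exists x i v, [/\ `|x| <= 1, `|v| <= 1 &
     l = matrix_coef x i v :> {linear tensor_op H n -> C}]].

(** The norm of A x is at most the sum of its n coordinate norms, and each coordinate norm is
    attained by pairing with its own normalised direction; hence the constant n. *)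
Lemma matrix_coefs_norming : norming matrix_coefs n%:R.
Proof.
split=> [|_ [x [i [v [x1 v1 ->]]]] A|A a a0 Aa]; first exact: ler0n.
  apply: le_trans (inner_contractive _ v1) _.
  apply: le_trans (l2sum_coord_le _ _) _; apply: le_trans (opnormP _ _) _.
  by rewrite ler_piMr// opnorm_ge0.
apply: opnorm_le => [|x]; first by rewrite mulr_ge0.
have [->|x0] := eqVneq x 0; first by rewrite bop0 !normr0 mulr0.
have nx : 0 < `|x| by rewrite normr_gt0.
apply: le_trans (l2sum_norm_le _) _.
have -> : n%:R * a * `|x| = \sum_(i < n) a * `|x|.
  by rewrite sumr_const card_ord -[RHS]mulr_natl mulrA.
apply: ler_sum => i _.
have [->|v0] := eqVneq (A x i) 0; first by rewrite normr0 mulr_ge0.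
have nv : 0 < `|A x i| by rewrite normr_gt0.
pose y := `|x|^-1 *: x; pose w := `|A x i|^-1 *: A x i.
have y1 : `|y| <= 1 by rewrite normrZ normfV normr_id mulVf ?gt_eqF.
have w1 : `|w| <= 1 by rewrite normrZ normfV normr_id mulVf ?gt_eqF.
have := Aa (matrix_coef y i w) (ex_intro _ y (ex_intro _ i (ex_intro _ w
  (And3 y1 w1 erefl)))).
rewrite /= /matrix_coef /w linearZr_LR/= /y bopZ ffunE linearZl_LR/= innerE.
rewrite /GRing.scale/= !normrM norm_conjC !normfV !normr_id.
rewrite mulrCA mulKf ?gt_eqF// mulrC => H1.
by rewrite -ler_pdivrMr.
Qed.

End hilbert_norming.

(** * Completeness of the operator space *)

Section tensor_op_complete.
Context {R : realType}.
Local Notation C := (Cplx R).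
Context {H : hilbertType C} (n : nat).

Definition cauchy_sequence (V : normedModType C) (a : nat -> V) :=
  forall e : C, 0 < e -> exists N, forall k m, (N <= k)%N -> (N <= m)%N ->
    `|a k - a m| < e.

Lemma cauchy_sequence_cvg (V : completeNormedModType C) (a : nat -> V) :
  cauchy_sequence a -> cvgn a.
Proof.
move=> ca; apply/cauchy_cvgP/cauchy_ballP => e e0.
have [N NP] := ca e e0.
exists ([set a k | k in [set k | (N <= k)%N]],
        [set a k | k in [set k | (N <= k)%N]]).
  by split; exists N => // k Nk; exists k.
by case=> _ _ [[k Nk <-] [m Nm <-]]; rewrite -ball_normE; exact: NP.
Qed.

(** Completeness comes from [H] coordinate by coordinate: the vectors [a k x i] are Cauchy in k at a
    rate proportional to |x|. This proportionality makes the limit bounded and the convergence one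
    in operator norm. *)
Lemma cauchy_sequence_tensor_op (a : nat -> tensor_op H n) :
  cauchy_sequence a -> cvgn a.
Proof.
move=> ca.
have diffE k m x i : a k x i - a m x i = (a k - a m) x i.
  by have -> : (a k - a m) x = a k x - a m x by []; rewrite !ffunE.
have ca_le e : 0 < e -> exists N, forall k m x i, (N <= k)%N -> (N <= m)%N ->
    `|a k x i - a m x i| <= e * `|x|.
  move=> e0; have [N NP] := ca _ e0; exists N => k m x i Nk Nm.
  rewrite diffE; apply: le_trans (l2sum_coord_le _ _) _.
  by apply: le_trans (opnormP _ _) _; rewrite ler_wpM2r// ltW// NP.
have [l lP] : exists l : l2sum n C -> 'I_n -> H,
    forall x i, (fun k => a k x i) @ \oo --> l x i.
  have : forall xi : l2sum n C * 'I_n, exists v : H,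
      (fun k => a k xi.1 xi.2) @ \oo --> v.
    move=> [x i] /=; apply/cvg_ex; apply: cauchy_sequence_cvg => e e0.
    have x1 : 0 < `|x| + 1 by rewrite ltr_wpDl.
    have [N NP] := ca_le _ (divr_gt0 e0 x1); exists N => k m Nk Nm.
    apply: le_lt_trans (NP k m x i Nk Nm) _.
    by rewrite mulrAC ltr_pdivrMr// ltr_pM2l// ltrDl.
  by move=> /choice[g gP]; exists (fun x i => g (x, i)) => x i;
    exact: (gP (x, i)).
pose g x : l2sum n H := [ffun i => l x i].
have g_le e : 0 < e -> exists N, forall k x, (N <= k)%N ->
    `|a k x - g x| <= n%:R * e * `|x|.
  move=> e0; have [N NP] := ca_le e e0; exists N => k x Nk.
  apply: le_trans (l2sum_norm_le _) _.
  have -> : n%:R * e * `|x| = \sum_(i < n) e * `|x|.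
    by rewrite sumr_const card_ord -[RHS]mulr_natl mulrA.
  apply: ler_sum => i _; rewrite !ffunE.
  apply: (@cvg_norm_le _ _ _ \oo _ (fun m => a k x i - a m x i)).
    by apply: cvgB; [exact: cvg_cst|exact: lP].
  by exists N => // m Nm; exact: NP.
have g_linear : linear g.
  move=> c x y; apply/ffunP => i; rewrite !ffunE.
  apply: (@cvg_unique _ (@norm_hausdorff _ H) _ _ _ _ (lP (c *: x + y) i)).
  have -> : (fun k => a k (c *: x + y) i) = (fun k => c *: a k x i + a k y i).
    by apply/funext => k; rewrite bop_linear !ffunE.
  by apply: cvgD; [apply: cvgZr; exact: lP|exact: lP].
have g_bounded : g \in @bounded_linear C (l2sum n C) (l2sum n H).
  apply/asboolP; split => //; have [N NP] := g_le 1 ltr01.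
  exists (opnorm (a N) + n%:R) => x.
  rewrite -[g x](subrK (a N x)) addrC mulrDl (le_trans (ler_normD _ _))//.
  rewrite lerD ?opnormP// distrC -[n%:R]mulr1; exact: NP.
pose G : tensor_op H n := Bop g_bounded.
apply/cvg_ex; exists G; apply/cvgrPdist_lt => e e0.
have n1 : 0 < n%:R + 1 :> C by rewrite ltr_wpDl.
have [N NP] := g_le _ (divr_gt0 e0 n1); exists N => // k Nk.
rewrite distrC; apply: (@le_lt_trans _ _ (n%:R * (e / (n%:R + 1)))).
  apply: opnorm_le => [|x]; last exact: NP.
  by rewrite mulr_ge0// ltW// divr_gt0.
by rewrite mulrCA gtr_pMr// ltr_pdivrMr// mul1r ltrDl.
Qed.

End tensor_op_complete.

(** * Limits of bounded holomorphic functions *)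

Section local_estimates.
Context {R : realType}.
Local Notation C := (Cplx R).
Context {X W : normedModType C}.
Implicit Types (f : X -> W) (x h : X) (M r : C).

Definition holo_bounded_ball f x r M := forall h, `|h| < r ->
  differentiable f (x + h) /\ `|f (x + h)| <= M.

(** The point is the order of the quantifiers: [c] is chosen before f and x, so the estimates hold
    for a whole sequence at once and pass to its limits. *)
Lemma local_estimates (L : set {linear W -> C}) (N : C) r M :
  norming L N -> 0 < r -> 0 <= M ->
  exists2 c : C, 0 <= c & forall f x, holo_bounded_ball f x r M ->
    (forall h, `|'d f x h| <= c * `|h|) /\
    (forall h, `|h| <= r / 8%:R -> `|f (x + h) - f x| <= c * `|h| /\
       `|f (x + h) - f x - 'd f x h| <= c * `|h| ^+ 2).
Proof.
move=> LN r0 M0; have [K K0 KP] := @vector_cauchy _ X _ _ _ LN.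
pose q : C := K * M / r ^+ 2; pose s : C := r / 8%:R.
have s0 : 0 < s by rewrite divr_gt0.
have q0 : 0 <= q by exact: divr_ge0 (mulr_ge0 K0 M0) (exprn_ge0 2 (ltW r0)).
pose b : C := (M + M + q * s ^+ 2) / s.
have b0 : 0 <= b.
  apply: divr_ge0 (ltW s0); apply: addr_ge0; first exact: addr_ge0.
  exact: mulr_ge0 q0 (exprn_ge0 2 (ltW s0)).
(* One constant for three bounds: [b] serves the differential, [b + q * s] the increment and [q] the
   quadratic remainder. *)
exists (b + q * s + q).
  by rewrite !addr_ge0// mulr_ge0// ltW.
move=> f x fP.
have quad h : `|h| <= s -> `|f (x + h) - f x - 'd f x h| <= q * `|h| ^+ 2.
  move=> hs; have := KP f x r M r0 (fun h hr => (fP h hr).1)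
    (fun h hr => (fP h hr).2) h hs.
  have -> : q * `|h| ^+ 2 = K * (M * (`|h| / r) ^+ 2); last by [].
  by rewrite /q; field; rewrite gt_eqF.
have fx : `|f x| <= M.
  by have [_] := fP 0 (eq_ind_r (fun z => z < r) r0 (normr0 _)); rewrite addr0.
have lin h : `|'d f x h| <= b * `|h|.
  have [->|h0] := eqVneq h 0; first by rewrite linear0 !normr0 mulr0.
  have nh : 0 < `|h| by rewrite normr_gt0.
  (* Rescale h to norm [s], the largest at which the quadratic estimate applies; there the
     differential is controlled by two values of f and the remainder. *)
  pose t : C := s / `|h|; have t0 : 0 < t by rewrite divr_gt0.
  have th : `|t *: h| = s by rewrite normrZ gtr0_norm// divfK// gt_eqF.
  have thr : `|t *: h| < r.
    by rewrite th /s ltr_pdivrMr// -[ltLHS]mulr1 ltr_pM2l// ltr1n.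
  have : `|'d f x (t *: h)| <= M + M + q * s ^+ 2.
    have := quad (t *: h); rewrite th lexx => /(_ isT) Q.
    rewrite -['d f x (t *: h)](subKr (f (x + t *: h) - f x)).
    apply: le_trans (ler_normB _ _) _; apply: lerD Q.
    by apply: le_trans (ler_normB _ _) _; apply: lerD fx; have [] := fP _ thr.
  rewrite linearZ normrZ gtr0_norm// => H.
  rewrite /b mulrAC ler_pdivlMr// -ler_pdivrMr//.
  by rewrite -mulrA mulrC.
split=> [h|h hs].
  apply: le_trans (lin h) _; apply: ler_wpM2r => //.
  by rewrite -addrA lerDl addr_ge0// mulr_ge0// ltW.
have qh : q * `|h| ^+ 2 <= q * s * `|h|.
  by rewrite expr2 mulrA ler_wpM2r// ler_wpM2l.
split; last first.
  apply: le_trans (quad h hs) _; apply: ler_wpM2r; first exact: exprn_ge0.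
  by rewrite lerDr addr_ge0// mulr_ge0// ltW.
rewrite -[_ - f x](subrK ('d f x h)).
apply: le_trans (ler_normD _ _) _.
apply: le_trans (lerD (le_trans (quad h hs) qh) (lin h)) _.
rewrite -mulrDl; apply: ler_wpM2r => //.
by rewrite addrC lerDl.
Qed.

(** Differentials are difference quotients up to an error that is O(t) uniformly in k. One small
    step t is fixed first, and then the Cauchy property is used at only two points. *)
Lemma diff_cauchy (L : set {linear W -> C}) (N : C) r M
    (f : nat -> X -> W) x : norming L N -> 0 < r -> 0 <= M ->
  (forall k, holo_bounded_ball (f k) x r M) ->
  (forall h, `|h| < r -> cauchy_sequence (fun k => f k (x + h))) ->
  forall h, cauchy_sequence (fun k => 'd (f k) x h).
Proof.
move=> LN r0 M0 fP cf h e e0.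
have [c c0 cP] := local_estimates LN r0 M0.
have h1 : 0 < `|h| + 1 by rewrite ltr_wpDl.
(* The first bound keeps t h within r / 8; the second forces the remainder c * |t h|^2 below t * e /
   8. *)
have [s s0 sP] := lt_min_pos (divr_gt0 (divr_gt0 r0 (ltr0n _ 8)) h1)
  (divr_gt0 e0 (mulr_gt0 (ltr0n _ 8) (mulr_gt0 (ltr_wpDl c0 ltr01)
     (exprn_gt0 2 h1)))).
pose t : C := s / 2%:R.
have t0 : 0 < t by rewrite divr_gt0.
have [tr te] : t < r / 8%:R / (`|h| + 1) /\
    t < e / (8%:R * ((c + 1) * (`|h| + 1) ^+ 2)).
  by apply: sP; rewrite ltr_pdivrMr// mulr_natr mulr2n ltrDl.
have thr : `|t *: h| <= r / 8%:R.
  rewrite normrZ gtr0_norm//; apply: (@le_trans _ _ (t * (`|h| + 1))).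
    by apply: ler_wpM2l; rewrite ?(ltW t0)// lerDl.
  by rewrite -ler_pdivlMr// ltW.
have r8 : r / 8%:R < r by rewrite ltr_pdivrMr// -[ltLHS]mulr1 ltr_pM2l// ltr1n.
have te4 : 0 < t * e / 4%:R by rewrite divr_gt0// mulr_gt0.
have [N1 N1P] := cf _ (le_lt_trans thr r8) _ te4.
have [N2 N2P] : exists N, forall k m, (N <= k)%N -> (N <= m)%N ->
    `|f k x - f m x| < t * e / 4%:R.
  by have := cf 0; rewrite normr0 addr0 => /(_ r0 _ te4).
exists (maxn N1 N2) => k m; rewrite !geq_max => /andP[k1 k2] /andP[m1 m2].
have est i : `|f i (x + t *: h) - f i x - t *: 'd (f i) x h| <= t * e / 8%:R.
  have [_ /(_ _ thr)[_]] := cP (f i) x (fP i).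
  rewrite linearZ => H; apply: le_trans H _.
  rewrite normrZ (gtr0_norm t0) exprMn expr2.
  have -> : c * (t * t * `|h| ^+ 2) = t * (t * (c * `|h| ^+ 2)) by ring.
  rewrite -mulrA; apply: ler_wpM2l; first exact: ltW.
  apply: (@le_trans _ _ (t * ((c + 1) * (`|h| + 1) ^+ 2))).
    apply: ler_wpM2l; first exact: ltW.
    apply: (ler_pM c0 (exprn_ge0 2 (normr_ge0 h))); first by rewrite lerDl.
    by apply: lerXn2r; rewrite ?nnegrE ?(ltW h1)// lerDl.
  have c1 : 0 < (c + 1) * (`|h| + 1) ^+ 2.
    by apply: mulr_gt0; [exact: ltr_wpDl|exact: exprn_gt0].
  rewrite ler_pdivlMr// -mulrA [_ * 8%:R]mulrC -ler_pdivlMr; first exact: ltW.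
  exact: mulr_gt0.
rewrite -(ltr_pM2l t0) -[X in X * _](gtr0_norm t0) -normrZ scalerBr.
pose D i := f i (x + t *: h) - f i x.
(* Four contributions, each below t * e / 4: two differences of values, at x + t h and at x, and the
   remainders of [f k] and [f m]. *)
have -> : t *: 'd (f k) x h - t *: 'd (f m) x h =
    (D k - D m) - (D k - t *: 'd (f k) x h) + (D m - t *: 'd (f m) x h).
  by rewrite [- (D k - _)]opprB (addrC (D k - D m)) !subrKA.
have -> : D k - D m =
    (f k (x + t *: h) - f m (x + t *: h)) - (f k x - f m x).
  by rewrite /D !opprD !opprK addrACA.
apply: le_lt_trans (ler_normD _ _) _.
have -> : t * e =
    t * e / 4%:R + t * e / 4%:R + t * e / 4%:R + t * e / 4%:R by field.
have e84 : t * e / 8%:R < t * e / 4%:R.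
  by rewrite ltr_pM2l ?mulr_gt0// ltf_pV2 ?posrE// ltr_nat.
apply: ltrD; last exact: le_lt_trans (est m) e84.
apply: le_lt_trans (ler_normB _ _) _.
apply: ltrD; last exact: le_lt_trans (est k) e84.
apply: le_lt_trans (ler_normB _ _) _.
by apply: ltrD; [exact: N1P|exact: N2P].
Qed.

(** The filter is arbitrary because two are needed: an ultrafilter for scalar functions and [\oo]
    for operator-valued ones. Convergence of the differentials is a hypothesis since its source
    differs: compactness of bounded sets of scalars, respectively [diff_cauchy] and completeness. *)
Lemma filter_limit_differentiable (L : set {linear W -> C}) (N : C) r M
    (I : Type) (F : set_system I) (FF : ProperFilter F)
    (f : I -> X -> W) (g : X -> W) x : norming L N -> 0 < r -> 0 <= M ->
  (forall i, holo_bounded_ball (f i) x r M) ->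
  (forall h, `|h| < r -> f i (x + h) @[i --> F] --> g (x + h)) ->
  (forall h, cvg ('d (f i) x h @[i --> F])) ->
  differentiable g x.
Proof.
move=> LN r0 M0 fP fg cd.
have [c c0 cP] := local_estimates LN r0 M0.
have [l lP] : exists l : X -> W, forall h, 'd (f i) x h @[i --> F] --> l h.
  have H h : exists v : W, 'd (f i) x h @[i --> F] --> v.
    by apply/cvg_ex; exact: cd.
  by have [l lP] := choice H; exists l.
have l_linear : linear l.
  move=> k u v.
  apply: (@cvg_unique _ (@norm_hausdorff _ W) _ _ _ _ (lP (k *: u + v))).
  have -> : (fun i => 'd (f i) x (k *: u + v)) =
      (fun i => k *: 'd (f i) x u + 'd (f i) x v).
    by apply/funext => i; rewrite linearP.
  by apply: cvgD; [apply: cvgZr; exact: lP|exact: lP].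
pose lL : {linear X -> W} :=
  HB.pack l (GRing.isLinear.Build C X W _ l l_linear).
apply: (proj1 (@differentiable_linear_eps _ _ _ g x lL c c0 _ _)) => [h|e e0].
  apply: (@cvg_norm_le _ _ _ F _ _ _ _ (lP h)).
  by apply: nearW => i; exact: (cP _ _ (fP i)).1.
have [s s0 sP] := lt_min_pos (divr_gt0 r0 (ltr0n _ 8))
  (divr_gt0 e0 (ltr_wpDl c0 ltr01)).
exists s => // h /sP[hr he].
have r8 : r / 8%:R < r by rewrite ltr_pdivrMr// -[ltLHS]mulr1 ltr_pM2l// ltr1n.
apply: (@le_trans _ _ (c * `|h| ^+ 2)).
  apply: (@cvg_norm_le _ _ _ F _ (fun i => f i (x + h) - f i x - 'd (f i) x h)).
    apply: cvgB; last exact: lP.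
    apply: cvgB; first by apply: fg; exact: lt_trans r8.
    by have := fg 0; rewrite normr0 addr0; exact.
  by apply: nearW => i; have [_ /(_ h (ltW hr))[]] := cP _ _ (fP i).
rewrite expr2 mulrA; apply: ler_wpM2r => //.
apply: (@le_trans _ _ ((c + 1) * `|h|)); first by apply: ler_wpM2r;
  rewrite ?lerDl.
by rewrite mulrC -ler_pdivlMr ?ltr_wpDl// ltW.
Qed.

End local_estimates.

(** * Vitali's theorem *)

Section ultralimits.
Context {R : realType}.
Local Notation C := (Cplx R).

Lemma ultra_image_near (I T : Type) (U : set_system I) (f : I -> T) :
  UltraFilter U -> UltraFilter (f @ U).
Proof.
move=> UU; have PU := @ultra_proper _ _ UU.
apply: Build_UltraFilter => G GF GU; apply/seteqP; split=> A; last exact: GU.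
move=> GA; have [|UnA] := in_ultra_setVsetC (f @^-1` A) UU; first by [].
have GnA : G (~` A) by apply: GU.
by have [x []] := filter_ex (filterI GA GnA).
Qed.

Lemma ultra_real_cvg (I : Type) (U : set_system I) (b : I -> R) (m : R) :
  UltraFilter U -> (forall i, `|b i| <= m) -> exists l : R, b @ U --> l.
Proof.
move=> UU bm; have PU := @ultra_proper _ _ UU.
have : compact (`[- m, m]%classic : set R) by exact: segment_compact.
rewrite compact_ultra.
move=> /(_ (b @ U) (ultra_image_near b UU)) []; last by move=> l [_ bl];
  exists l.
by apply: nearW => i /=; rewrite in_itv/= -ler_norml.
Qed.

Lemma ultra_complex_cvg (I : Type) (U : set_system I) (a : I -> C) (M : C) :
  UltraFilter U -> (forall i, `|a i| <= M) -> exists l : C, a @ U --> l.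
Proof.
move=> UU aM; have PU := @ultra_proper _ _ UU.
have [[p ap] [q aq]] : (exists p : R, complex.Re (a i) @[i --> U] --> p) /\
    (exists q : R, complex.Im (a i) @[i --> U] --> q).
  split; apply: (@ultra_real_cvg _ _ _ (complex.Re M)) => // i;
    apply: (@Re_le R _%:C%C M); apply: le_trans (aM i).
    exact: Re_norm_le.
  exact: Im_norm_le.
exists (p +i* q)%C.
have -> : a = (fun i => (complex.Re (a i) +i* complex.Im (a i))%C).
  by apply/funext => i; case: (a i).
exact: cplx_cvg.
Qed.

End ultralimits.

Section scalar_norming.
Context {R : realType}.
Local Notation C := (Cplx R).

Lemma scalar_norming :
  norming [set l : {linear C -> C} | l = idfun :> (C -> C)] 1.
Proof.
split=> [|l lid w|w a a0 /(_ [the {linear C -> C} of idfun] erefl)].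
- exact: ler01.
- by rewrite lid.
- by rewrite mul1r.
Qed.

End scalar_norming.

(** * Balls of uniform control, and graded functions living on one level *)

Section pointwise_convergence.
Context {R : realType} {d : nat} {H : hilbertType (Cplx R)}.
Local Notation C := (Cplx R).
Implicit Types (Omega : set (mspace R d)) (u : nat -> graded_fun d H).

Lemma holo_ball Omega u n (x : mtuple R d n.+1) :
  finitely_open Omega -> (forall k, Hol Omega (u k)) ->
  finitely_locally_uniformly_bounded Omega u -> slice Omega n x ->
  exists r : C, exists M : C, [/\ 0 < r, 0 <= M,
    forall h, `|h| < r -> slice Omega n (x + h) &
    forall k, holo_bounded_ball (@restrict_level R d H (u k) n) x r M].
Proof.
move=> oO hu bu Ox.
have [B [oB Bx BO [M MP]]] := bu _ Ox.
have /nbhs_normP[r r0 rP] : nbhs x (slice B n) by apply: open_nbhs_nbhs; split.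
have Br h : `|h| < r -> B (existT _ n (x + h)).
  by move=> hr; apply: rP; rewrite /= opprD addrA subrr sub0r normrN.
exists r, M; split => //.
- by have := MP 0 _ Bx; apply: le_trans.
- by move=> h /Br/BO.
- move=> k h /Br Bh; split; first by apply: hu; exact: BO.
  exact: (MP k (existT _ n (x + h)) Bh).
Qed.

(** This turns a scalar function into a competitor for the uniqueness hypothesis. The matrix size is
    part of the type, so the value on level m is transported along a proof of n = m; all other
    levels receive 0. *)
Definition single_level n (g : mtuple R d n.+1 -> C) (A : tensor_op H n.+1) :
    graded_fun d H :=
  fun l => let: existT m x := l return tensor_op H (level l) in
    if pselect (n = m) is left e then
      eq_rect n (fun m => mtuple R d m.+1 -> tensor_op H m.+1)
        (fun y => g y *: A) m e x
    else 0.

Lemma single_levelE n g A (x : mtuple R d n.+1) :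
  single_level g A (existT _ n x) = g x *: A.
Proof.
rewrite /single_level; case: pselect => // e.
by rewrite (eq_irrelevance e erefl).
Qed.

Lemma single_level0 n m (g : mtuple R d n.+1 -> C) A (x : mtuple R d m.+1) :
  n <> m -> single_level g A (existT _ m x) = 0.
Proof. by rewrite /single_level; case: pselect. Qed.

Lemma single_level_Hol Omega n (g : mtuple R d n.+1 -> C) A :
  (forall x, slice Omega n x -> differentiable g x) ->
  Hol Omega (single_level g A).
Proof.
move=> dg m x Ox; have [nm|nm] := pselect (n = m).
  subst m.
  have -> : @restrict_level R d H (single_level g A) n = (fun y => g y *: A).
    by apply/funext => y; exact: single_levelE.
  by apply: differentiableZl; exact: dg.
have -> : @restrict_level R d H (single_level g A) m = cst 0.
  by apply/funext => y; exact: single_level0.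
exact: differentiable_cst.
Qed.

End pointwise_convergence.

(** * Pointwise Cauchy property and locally uniform convergence *)

Section vitali.
Context {R : realType} {d : nat} {H : hilbertType (Cplx R)}.
Local Notation C := (Cplx R).
Implicit Types (Omega : set (mspace R d)) (lam : nat -> mspace R d).
Implicit Types (u : nat -> graded_fun d H).

(* If not, functionals [l j] keep the differences [D j] of values of [u] away
   from [0] at [x0]; an ultralimit [g] of the scalar functions [l j \o D j] is
   holomorphic, vanishes at every [lam i], but not at [x0]. *)
Lemma pointwise_cauchy Omega lam u n (x0 : mtuple R d n.+1) :
  finitely_open Omega -> set_of_uniqueness H Omega lam ->
  (forall k, Hol Omega (u k)) ->
  finitely_locally_uniformly_bounded Omega u ->
  (forall i, cvgn (fun k => u k (lam i))) ->
  slice Omega n x0 ->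
  cauchy_sequence (fun k => restrict_level (u k) x0).
Proof.
move=> oOmega lamU uHol ubound ulam Ox0; apply: contrapT => nc.
have [e e0 eP] : exists2 e : C, 0 < e & forall N, exists km : nat * nat,
    [/\ (N <= km.1)%N, (N <= km.2)%N &
      ~ `|restrict_level (u km.1) x0 - restrict_level (u km.2) x0| < e].
  apply: contrapT => nE; apply: nc => e e0; apply: contrapT => nN.
  apply: nE; exists e => // N; apply: contrapT => nkm; apply: nN; exists N.
  move=> k m Nk Nm; apply: contrapT => nlt; apply: nkm.
  by exists (k, m).
have [km kmP] := choice eP.
pose D j (x : mtuple R d n.+1) : tensor_op H n.+1 :=
  restrict_level (u (km j).1) x - restrict_level (u (km j).2) x.
have LN := @matrix_coefs_norming R H n.+1.
set N : C := n.+1%:R in LN.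
have N1 : 0 < N + 1 by rewrite ltr_wpDl// ler0n.
(* If every functional were at most [a] on [D j x0], its norm would be at most [N * a < e], against
   the choice of [km j]. *)
pose a := e / (N + 1).
have a0 : 0 < a by rewrite divr_gt0.
have lex j : exists l : {linear tensor_op H n.+1 -> C},
    matrix_coefs l /\ ~ `|l (D j x0)| <= a.
  apply: contrapT => nl; have [_ _] := kmP j; apply.
  apply: (@le_lt_trans _ _ (N * a)).
    case: LN => _ _; apply=> [|l Ll]; first exact: ltW.
    by apply: contrapT => nle; apply: nl; exists l.
  by rewrite /a mulrA ltr_pdivrMr// mulrC ltr_pM2l// ltrDl.
have [l lP] := choice lex.
have lcontr j : contractive (l j).
  by case: LN => _ + _; apply; have [] := lP j.
(* [U] refines [\oo]: whatever holds for all large j holds along [U], and bounded scalar sequences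
   acquire limits. *)
have [U [UU leU]] := @ultraFilterLemma _ \oo _.
have PU := @ultra_proper _ _ UU.
pose f j x : C := l j (D j x).
pose g x : C := lim (f j x @[j --> U]).
have ball x : slice Omega n x -> exists r : C, exists M : C,
    [/\ 0 < r, 0 <= M, forall h, `|h| < r -> slice Omega n (x + h) &
    forall j, holo_bounded_ball (f j) x r M].
  move=> Ox; have [r [M [r0 M0 rO rM]]] := holo_ball oOmega uHol ubound Ox.
  exists r, (M + M); split => // [|j h hr]; first exact: addr_ge0.
  have [d1 b1] := rM (km j).1 h hr; have [d2 b2] := rM (km j).2 h hr.
  split; last first.
    apply: le_trans (lcontr j _) _; apply: le_trans (ler_normB _ _) _.
    by apply: lerD; [exact: b1|exact: b2].
  have dD : differentiable (D j) (x + h) by exact: differentiableB.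
  have cl : continuous (l j).
    apply: (lipschitz_linear_continuous ler01) => w.
    by rewrite mul1r; exact: lcontr.
  exact: (@differentiable_comp _ _ _ _ (D j) (l j) (x + h) dD
    (@linear_differentiable _ _ _ (l j) (D j (x + h)) cl)).
have fg x : slice Omega n x -> f j x @[j --> U] --> g x.
  move=> Ox; have [r [M [r0 M0 rO rM]]] := ball x Ox.
  have fM j : `|f j x| <= M.
    by have [_] := rM j 0 (eq_ind_r (fun z => z < r) r0 (normr0 _));
      rewrite addr0.
  have [z fz] := ultra_complex_cvg UU fM.
  by rewrite /g (cvg_lim _ fz)//; exact: norm_hausdorff.
have dg x : slice Omega n x -> differentiable g x.
  move=> Ox; have [r [M [r0 M0 rO rM]]] := ball x Ox.
  apply: (@filter_limit_differentiable _ _ _ _ _ _ _ _ _ PU f g x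
    scalar_norming r0 M0 rM) => [h /rO|h]; first exact: fg.
  have [c c0 cP] := @local_estimates _ (mtuple R d n.+1) _ _ _ _ _
    (@scalar_norming R) r0 M0.
  apply/cvg_ex; apply: (ultra_complex_cvg UU (M := c * `|h|)) => j.
  exact: (cP _ _ (rM j)).1.
(* Both indices in [km j] are at least j, so at a point [lam i] of level n the two terms of [D j]
   approach the same limit. Contractivity carries this over to [l j], although the functional
   changes with j. *)
have glam i : single_level g (D 0%N x0) (lam i) = 0.
  have := @ulam i; case: (lam i) => m x.
  have [nm|nm] := pselect (n = m); last by rewrite single_level0.
  subst m; rewrite single_levelE => /cvg_ex[v /cvgrPdist_lt uv].
  suff fx : f j x @[j --> U] --> (0 : C).
    have -> : g x = 0 by apply: cvg_lim fx; exact: norm_hausdorff.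
    by rewrite scale0r.
  apply/cvgrPdist_lt => t t0; have t2 : 0 < t / 2%:R by rewrite divr_gt0.
  have [K _ KP] := uv _ t2; apply: leU; exists K => // j /= Kj.
  have [j1 j2 _] := kmP j.
  rewrite sub0r normrN; apply: le_lt_trans (lcontr j _) _.
  have -> : D j x = (u (km j).1 (existT _ n x) - v) -
      (u (km j).2 (existT _ n x) - v).
    by rewrite opprB addrA subrK.
  rewrite (splitr t); apply: le_lt_trans (ler_normB _ _) _.
  apply: ltrD; rewrite distrC; apply: KP => /=; exact: leq_trans Kj _.
have : single_level g (D 0%N x0) (existT _ n x0) = 0.
  by apply: lamU glam _ Ox0; exact: single_level_Hol dg.
(* A product [g x0 *: D 0 x0] equal to 0 leaves two cases: g(x0) = 0 contradicts that no |f j x0| is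
   at most [a], and [D 0 x0 = 0] contradicts the same property of [l 0]. *)
rewrite single_levelE => /eqP; rewrite scaler_eq0 => /orP[|] /eqP g0.
  have /cvgrPdist_lt/(_ a a0)/filter_ex[j] := fg x0 Ox0.
  by rewrite g0 sub0r normrN => /ltW; case: (lP j).
by case: (lP 0%N) => _; apply; rewrite g0 linear0 normr0 ltW.
Qed.

(** Near x all [u k] share one Lipschitz bound at x, which [v] inherits in the limit; convergence at
    x alone then spreads to a neighbourhood by an e / 3 argument. The joint [near] statement is the
    form consumed by the covering description of compactness. *)
Lemma locally_uniform_cvg Omega u (v : graded_fun d H) n (x : mtuple R d n.+1) :
  finitely_open Omega -> (forall k, Hol Omega (u k)) ->
  finitely_locally_uniformly_bounded Omega u ->
  (forall l, Omega l -> u k l @[k --> \oo] --> v l) ->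
  slice Omega n x -> forall e : C, 0 < e ->
  \forall y \near x & k \near \oo,
    `|restrict_level (u k) y - restrict_level v y| < e.
Proof.
move=> oO hu bu uv Ox e e0.
have [r [M [r0 M0 rO rM]]] := holo_ball oO hu bu Ox.
have [c c0 cP] := @local_estimates _ (mtuple R d n.+1) _ _ _ _ _
  (@matrix_coefs_norming R H n.+1) r0 M0.
have uvn y : slice Omega n y ->
    restrict_level (u k) y @[k --> \oo] --> restrict_level v y.
  by move=> Oy; exact: (uv (existT _ n y) Oy).
have r8 : r / 8%:R < r by rewrite ltr_pdivrMr// -[ltLHS]mulr1 ltr_pM2l// ltr1n.
have ulip k h : `|h| <= r / 8%:R ->
    `|restrict_level (u k) (x + h) - restrict_level (u k) x| <= c * `|h|.
  move=> hr; have [_ P] := cP _ _ (rM k).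
  by have [P1 _] := P h hr; exact: P1.
have vlip h : `|h| <= r / 8%:R ->
    `|restrict_level v (x + h) - restrict_level v x| <= c * `|h|.
  move=> hr; apply: (@cvg_norm_le _ _ nat \oo _ (fun k =>
    restrict_level (u k) (x + h) - restrict_level (u k) x)
    (restrict_level v (x + h) - restrict_level v x) (c * `|h|)).
    apply: cvgB; last exact: uvn.
    by apply: uvn; apply: rO; exact: le_lt_trans r8.
  by apply: nearW => k; exact: ulip.
have e3 : 0 < e / 3%:R by rewrite divr_gt0.
have [s s0 sP] := lt_min_pos (divr_gt0 r0 (ltr0n _ 8))
  (divr_gt0 e3 (ltr_wpDl c0 ltr01)).
have /cvgrPdist_lt/(_ _ e3)[K _ KP] := uvn x Ox.
have xs := near_dist_lt x s0.
exists ([set y | `|y - x| < s], [set k | (K <= k)%N]).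
  by split; [exact: xs|exists K].
move=> [y k] /= [yx Kk].
have [yr ye] := sP _ yx.
have ce : c * `|y - x| < e / 3%:R.
  apply: (@le_lt_trans _ _ ((c + 1) * `|y - x|)).
    by apply: ler_wpM2r; rewrite ?lerDl.
  by rewrite mulrC -ltr_pdivlMr ?ltr_wpDl.
have yE : y = x + (y - x) by rewrite addrC subrK.
have := ulip k _ (ltW yr); have := vlip _ (ltW yr); rewrite -yE => V Uk.
have {KP} := KP k Kk; move: V Uk.
set a := restrict_level (u k) y; set b := restrict_level v y.
set p := restrict_level (u k) x; set q := restrict_level v x => V Uk KP.
clearbody p q a b; apply: le_lt_trans (ler_distD p a b) _.
have -> : e = e / 3%:R + (e / 3%:R + e / 3%:R) by field.
apply: ltrD; first exact: (le_lt_trans Uk ce).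
apply: le_lt_trans (ler_distD q p b) _.
by rewrite (distrC p q) (distrC q b); apply: ltrD KP (le_lt_trans V ce).
Qed.

End vitali.

Theorem proposition6p2 (R : realType) (d : nat) (H : hilbertType (Cplx R))
    (Omega : set (mspace R d)) (lam : nat -> mspace R d)
    (u : nat -> graded_fun d H) :
  finitely_open Omega ->
  (forall i, Omega (lam i)) ->
  set_of_uniqueness H Omega lam ->
  (forall k, Hol Omega (u k)) ->
  finitely_locally_uniformly_bounded Omega u ->
  (forall i, cvgn (fun k => u k (lam i))) ->
  exists2 v : graded_fun d H, Hol Omega v & cvg_in_Hol Omega u v.
Proof.
move=> oO _ lamU hu bu ulam.
have cu n (x : mtuple R d n.+1) : slice Omega n x ->
    cauchy_sequence (fun k => restrict_level (u k) x).
  exact: pointwise_cauchy oO lamU hu bu ulam.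
(* Off [Omega] this [lim] may be a default value; the conclusion concerns [v] on [Omega] only. *)
pose v : graded_fun d H := fun l => lim (u k l @[k --> \oo]).
have uv l : Omega l -> u k l @[k --> \oo] --> v l.
  case: l => n x Ox.
  have c : cvgn (fun k => restrict_level (u k) x).
    exact: cauchy_sequence_tensor_op (cu n x Ox).
  exact: c.
exists v.
  move=> n x Ox.
  have [r [M [r0 M0 rO rM]]] := holo_ball oO hu bu Ox.
  have LN := @matrix_coefs_norming R H n.+1.
  have cr h : `|h| < r ->
      cauchy_sequence (fun k => restrict_level (u k) (x + h)).
    by move=> /rO; exact: cu.
  apply: (@filter_limit_differentiable _ _ _ _ _ r M nat \oo _
    (fun k => @restrict_level R d H (u k) n) (@restrict_level R d H v n) x
    LN r0 M0 rM) => [h hr|h].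
    exact: (uv (existT _ n (x + h)) (rO h hr)).
  apply: cauchy_sequence_tensor_op.
  exact: (diff_cauchy LN r0 M0 rM cr).
move=> K [cK [N KN]] KO e e0.
have level_cvg n : \forall k \near \oo, forall x, slice K n x ->
    `|restrict_level (u k) x - restrict_level v x| < e.
  have := cK n; rewrite compact_near_coveringP.
  apply=> x Kx; exact: (locally_uniform_cvg oO hu bu uv (KO _ Kx) e0).
(* Only the levels below [N] can meet [K], so finitely many thresholds are combined. *)
have : \forall k \near \oo, forall n : 'I_N, forall x, slice K n x ->
    `|restrict_level (u k) x - restrict_level v x| < e.
  by apply: filter_forall => n; exact: level_cvg.
apply: filterS => k kP [n x] Kx.
have [nN|Nn] := ltnP n N; first exact: (kP (Ordinal nN) x Kx).
by have : slice K n x by []; rewrite KN.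
Qed.
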